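(* Let $H$ be a real Hilbert space, $\mathbb B_H=\{x\in H:|x|<1\}$, let $K\ge1$, let $F:\mathbb D\to\mathbb B_H$ be harmonic, and let $z_0\in\mathbb D$. If $F$ is $K$-quasiconformal at $z_0$ in the pointwise sense, then, for every $v\in T_{z_0}\mathbb D=\mathbb R^2$, $$\mathrm{CK}_{\mathbb B_H}\bigl(F(z_0);dF_{z_0}v\bigr)\le K\,P_{\mathbb D}(z_0;v).$$ More precisely, put $p=F(z_0)$, $\Lambda=dF_{z_0}(\mathbb R^2)$, let $\pi_\Lambda$ be the orthogonal projection of $H$ onto $\Lambda$, and $$c=\sqrt{1-|p|^2+|\pi_\Lambda p|^2},\qquad s=\frac{|\pi_\Lambda p|}{c}.$$ Then $0\le s<1$ and $$\mathrm{CK}_{\mathbb B_H}(p;dF_{z_0}v)\le\frac{2K}{K+1-(K-1)s^2}\,P_{\mathbb D}(z_0;v).$$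
   Context: $\mathbb D$ is the open unit disk in $\mathbb C$. A $C^2$ map $F:\mathbb D\to H$ is harmonic if $\Delta F=0$. The maximal and minimal stretchings are $L_F(z_0)=\max_{|v|=1}|dF_{z_0}v|$ and $\ell_F(z_0)=\min_{|v|=1}|dF_{z_0}v|$. $F$ is $K$-quasiconformal at $z_0$ in the pointwise sense if $0<\ell_F(z_0)\le L_F(z_0)\le K\ell_F(z_0)$ (a condition on the differential at $z_0$ only). For $p\in\mathbb B_H$, $v\in H$, $$\mathrm{CK}_{\mathbb B_H}(p;v)=\frac{\sqrt{(1-|p|^2)|v|^2+\langle p,v\rangle^2}}{1-|p|^2},$$ and for $z\in\mathbb D$, $v\in\mathbb R^2$, $P_{\mathbb D}(z;v)=\dfrac{|v|}{1-|z|^2}$. *)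

(* Defs.v *)
From HB Require Import structures.
From mathcomp Require Import all_boot all_order all_algebra.
From mathcomp Require Import all_classical all_reals all_analysis.

Set Implicit Arguments.
Unset Strict Implicit.
Unset Printing Implicit Defensive.

Import Order.TTheory GRing.Theory Num.Theory.
Import numFieldNormedType.Exports.

Local Open Scope classical_set_scope.
Local Open Scope ring_scope.

(* The plane is [R * R].  The library's norm there is the sup norm: it gives the
   right topology, hence the right derivatives, but not the right lengths, so
   lengths of plane vectors are always measured with [eucl]. *)
Definition eucl (R : realType) (v : R * R) : R :=
  Num.sqrt (v.1 ^+ 2 + v.2 ^+ 2).

Definition unit_disk (R : realType) : set (R * R) := [set z | eucl z < 1].

Arguments unit_disk : clear implicits.

(* A real Hilbert space is a complete normed module together with a symmetric
   positive definite bilinear form inducing its norm. *)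
Definition induces_norm (R : realType) (H : completeNormedModType R)
    (ip : {dot H for idfun}) : Prop :=
  forall x : H, `|x| = Num.sqrt (ip x x).

(* Maps are total functions on the plane, of which only the values on the open
   set [U] matter.  As the plane is finite-dimensional, regularity of
   [z |-> dF_z] amounts to regularity of [z |-> dF_z v] for each fixed [v]. *)
Fixpoint smooth_on (R : realType) (H : normedModType R) (n : nat)
    (U : set (R * R)) (F : R * R -> H) : Prop :=
  match n with
  | 0%N => forall z, U z -> continuous_at z F
  | m.+1 => (forall z, U z -> differentiable F z) /\
            (forall v : R * R, smooth_on m U (fun z => 'd F z v))
  end.

Definition laplacian (R : realType) (H : normedModType R)
    (F : R * R -> H) (z : R * R) : H :=
  'D_((1, 0) : R * R) ('D_((1, 0) : R * R) F) z +
  'D_((0, 1) : R * R) ('D_((0, 1) : R * R) F) z.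

Definition harmonic_on (R : realType) (H : normedModType R)
    (U : set (R * R)) (F : R * R -> H) : Prop :=
  smooth_on 2 U F /\ (forall z, U z -> laplacian F z = 0).

(* At a point of differentiability the extrema are attained, the unit circle
   being compact. *)
Definition max_stretching (R : realType) (H : normedModType R)
    (F : R * R -> H) (z : R * R) : R :=
  sup [set `|'d F z v| | v in [set v : R * R | eucl v = 1]].

Definition min_stretching (R : realType) (H : normedModType R)
    (F : R * R -> H) (z : R * R) : R :=
  inf [set `|'d F z v| | v in [set v : R * R | eucl v = 1]].

Definition quasiconformal_at (R : realType) (H : normedModType R)
    (K : R) (F : R * R -> H) (z : R * R) : Prop :=
  [/\ 0 < min_stretching F z,
      min_stretching F z <= max_stretching F z
    & max_stretching F z <= K * min_stretching F z].

(* [get] picks the point satisfying the predicate, which exists and is unique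
   whenever [L] is a complete (e.g. finite-dimensional) subspace. *)
Definition orth_proj (R : realType) (H : completeNormedModType R)
    (ip : {dot H for idfun}) (L : set H) (x : H) : H :=
  get [set y | L y /\ forall w, L w -> ip (x - y) w = 0].

Definition cayley_klein (R : realType) (H : completeNormedModType R)
    (ip : {dot H for idfun}) (p v : H) : R :=
  Num.sqrt ((1 - `|p| ^+ 2) * `|v| ^+ 2 + ip p v ^+ 2) / (1 - `|p| ^+ 2).

Definition poincare (R : realType) (z v : R * R) : R :=
  eucl v / (1 - eucl z ^+ 2).

(* Main.v *)
Require Import Defs.
From HB Require Import structures.
From mathcomp Require Import all_boot all_order all_algebra.
From mathcomp Require Import all_classical all_reals all_analysis.
From mathcomp Require Import ring lra.
Import Order.TTheory GRing.Theory Num.Theory.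
Import numFieldNormedType.Exports.
Local Open Scope classical_set_scope.
Local Open Scope ring_scope.
Set Implicit Arguments.
Unset Strict Implicit.
Unset Printing Implicit Defensive.

(** Let [u] run over the scalar components [ip (F z) y]
   of [F].  Composed with the Moebius map [mob] of the disk with [mob 0 = z0],
   [u] stays harmonic, so its integrals over a circle of radius [r] against [1],
   [cos] and [sin] only see its value and its differential at [z0]
   ([harmonic_pairing]).  Hence, for an [H]-valued trigonometric polynomial [G]
   of degree one, the integral of [ip (F (mob (r e^(it)))) (G t)] is an explicit
   linear expression in [F z0] and ['d F z0]; as [F] maps into the unit ball, it
   is at most the integral of [`|G t|].

   The optimal [G] comes from the affine disk [(p + Lambda)] cut out of the
   ball.  That disk has radius [c] and centre [n = p - q], and in the complex
   coordinate [zeta] of its boundary the conformal parametrization sending [0] to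
   [p] is [n + c (zeta + a) / (1 + conj a zeta)], with [|a| = s].  It has norm
   one on the unit circle, and multiplied by [rho = |1 + conj a zeta|^2] it
   becomes the polynomial [rho n + c (zeta + 2 a + a^2 conj zeta)], whose norm is
   [rho] ([test_field_norm]).  Taking for [zeta] the angular variable of the
   source in an orthonormal frame in which ['d F z0] is diagonal, with singular
   values [l <= L <= K l], and letting [r] tend to [1], the bound becomes
   ([field_estimate])
     [(1 - |z0|^2) (L (1 + d) + l (1 - d)) <= 2 c (1 - s^2)],  [d = Re (a^2)].
   Since [d >= - s^2] and [L <= K l], the left-hand side is at least
   [(1 - |z0|^2) L (K + 1 - (K - 1) s^2) / K].  On the other side, the
   Cayley-Klein length of a vector [w] of [Lambda] is at most
   [|w| / (c (1 - s^2))], because [ip p w = ip q w] and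
   [1 - |p|^2 = c^2 (1 - s^2)]; and [|'d F z0 v| <= L |v|].

   The moments of a harmonic function are computed in polar coordinates: if
   [g'' = - l g] with [g] periodic, then [A(r)], the integral of
   [w(r, t) g(t)], satisfies [r^2 A'' + r A' = l A] ([moment_ode]), and smoothness
   at [r = 0] forces [A] constant for [l = 0] ([moment0]) and [A(r) = r A'(0)]
   for [l = 1] ([moment1]). *)

(** * Integration over a period *)

Section CircleIntegral.
Context {R : realType}.
Implicit Types (f g : R -> R) (t : R).

Definition circle_int f : R :=
  \int[lebesgue_measure]_(t in `[0, 2 * pi]) f t.

Lemma two_pi_gt0 : 0 < 2 * pi :> R.
Proof. by rewrite mulr_gt0 ?pi_gt0. Qed.

Lemma circle_integrable f : continuous f ->
  lebesgue_measure.-integrable `[0, 2 * pi] (EFin \o f).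
Proof.
move=> cf; apply: continuous_compact_integrable; first exact: segment_compact.
exact: continuous_subspaceT.
Qed.

Lemma circle_intD f g : continuous f -> continuous g ->
  circle_int (fun t => f t + g t) = circle_int f + circle_int g.
Proof. by move=> cf cg; rewrite /circle_int RintegralD//; exact: circle_integrable. Qed.

Lemma circle_intZ k f : continuous f ->
  circle_int (fun t => k * f t) = k * circle_int f.
Proof. by move=> cf; rewrite /circle_int RintegralZl//; exact: circle_integrable. Qed.

Lemma circle_int_cst k : circle_int (fun=> k) = 2 * pi * k.
Proof.
rewrite /circle_int Rintegral_cst//.
have := lebesgue_measure_itv (`[0, 2 * pi] : interval R).
rewrite /= lte_fin two_pi_gt0 => ->.
by rewrite oppr0 adde0 mulrC.
Qed.

Lemma circle_int_le f g : continuous f -> continuous g ->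
  (forall t, f t <= g t) -> circle_int f <= circle_int g.
Proof.
by move=> cf cg fg; apply: le_Rintegral => //; exact: circle_integrable.
Qed.

Lemma is_derive_continuous (x df : R) f : is_derive x 1 f df -> {for x, continuous f}.
Proof.
by move=> [/derivable1_diffP df' _]; exact: differentiable_continuous.
Qed.

(** The source of every cancellation below: a periodic function has a derivative
   of zero mean. *)
Lemma circle_int_derive f g : (forall t, is_derive t 1 f (g t)) ->
  continuous g -> f (2 * pi) = f 0 -> circle_int g = 0.
Proof.
move=> dfg cg f2pi.
have cf : continuous f by move=> t; exact: is_derive_continuous (dfg t).
rewrite /circle_int /Rintegral (@continuous_FTC2 _ g f) ?two_pi_gt0//.
- by rewrite f2pi -EFinB subrr.
- exact: continuous_subspaceT.
- split.
  + by move=> t _; have [] := dfg t.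
  + exact/cvg_at_right_filter/cf.
  + exact/cvg_at_left_filter/cf.
- by move=> t _; rewrite derive1E; have [_ ->] := dfg t.
Qed.

Lemma is_derive_mul f g df dg (x : R) : is_derive x 1 f df -> is_derive x 1 g dg ->
  is_derive x 1 (fun y => f y * g y) (df * g x + f x * dg).
Proof.
move=> hf hg; apply: is_derive_eq.
by rewrite /GRing.scale/=; ring.
Qed.

Lemma is_derive_const (k x : R) : is_derive x 1 (fun=> k) 0.
Proof. exact: is_derive_cst. Qed.

Lemma is_derive_add f g df dg (x : R) : is_derive x 1 f df -> is_derive x 1 g dg ->
  is_derive x 1 (fun y => f y + g y) (df + dg).
Proof. by move=> hf hg; apply: is_deriveD. Qed.

(** Differentiability is only asked for inside the interval: at the centre of the
   disk the polar equations degenerate, and the value there is reached by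
   continuity. *)
Lemma derive_cst_on f (r : R) : 0 < r ->
  (forall x, 0 <= x <= r -> {for x, continuous f}) ->
  (forall x, 0 < x < r -> is_derive x 1 f 0) -> f r = f 0.
Proof.
move=> r0 cf df.
have df' x : x \in `]0, r[ -> is_derive x 1 f 0 by rewrite in_itv/=; exact: df.
have cf' : {within `[0, r], continuous f}.
  by apply/continuous_in_subspaceT => x; rewrite inE/= in_itv/=; exact: cf.
have [c _] := @MVT R f (fun=> 0) 0 r r0 df' cf'.
by rewrite mul0r => /eqP; rewrite subr_eq0 => /eqP.
Qed.

Lemma is_derive_circle_int (f f1 : R -> R -> R) (r b M : R) :
  -b < r < b ->
  (forall x, -b < x < b -> continuous (f x)) ->
  (forall x t, -b < x < b -> is_derive x 1 (f^~ t) (f1 x t)) ->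
  (forall x t, -b < x < b -> 0 <= t <= 2 * pi -> `|f1 x t| <= M) ->
  is_derive r 1 (fun x => circle_int (f x)) (circle_int (f1 r)).
Proof.
move=> rb cf df fM.
have M0 : 0 <= M.
  apply: le_trans (fM r 0 rb _); first exact: normr_ge0.
  by rewrite lexx/= ltW ?two_pi_gt0.
have Ir : `](-b), b[%classic r by rewrite /= in_itv.
have intf x : `](-b), b[%classic x ->
    lebesgue_measure.-integrable `[0, 2 * pi] (EFin \o f x).
  by rewrite /= in_itv/= => xb; apply: circle_integrable; exact: cf.
have drf x y : `](-b), b[%classic x -> `[0, 2 * pi]%classic y -> derivable (f^~ y) x 1.
  by rewrite /= in_itv/= => xb _; have [] := df x y xb.
have intM : lebesgue_measure.-integrable `[0, 2 * pi] (EFin \o (cst M : R -> R)).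
  by apply: circle_integrable => x; exact: cvg_cst.
have p1 x y : `](-b), b[%classic x -> partial1of2 f x y = f1 x y.
  rewrite /= in_itv/= => xb; rewrite partial1of2E.
  by have [_] := df x y xb.
have Mub x y : `](-b), b[%classic x -> `[0, 2 * pi]%classic y -> `|partial1of2 f x y| <= cst M y.
  move=> Ix; rewrite p1//; move: Ix; rewrite /= !in_itv/=; exact: fM.
have mI : measurable (`[0, 2 * pi] : set R) by [].
split.
  exact: (@derivable_under_integral R _ _ lebesgue_measure f _ mI r _ _ Ir
    intf drf (cst M) (fun=> M0) intM Mub).
rewrite -derive1E.
rewrite (@differentiation_under_integral R _ _ lebesgue_measure f _ mI r _ _ Ir
    intf drf (cst M) (fun=> M0) intM Mub).
by apply: eq_Rintegral => y _; rewrite p1.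
Qed.

End CircleIntegral.

(** * Moments of harmonic functions in polar coordinates *)

Section PolarHarmonic.
Context {R : realType}.
Implicit Types (f g : R -> R) (r t : R).

Lemma continuous_mul f g : continuous f -> continuous g -> continuous (fun t => f t * g t).
Proof. by move=> cf cg t; apply: cvgM; [exact: cf|exact: cg]. Qed.

Lemma continuous_add f g : continuous f -> continuous g -> continuous (fun t => f t + g t).
Proof. by move=> cf cg t; apply: cvgD; [exact: cf|exact: cg]. Qed.

Lemma continuous_scale k f : continuous f -> continuous (fun t => k * f t).
Proof. by move=> cf t; apply: cvgM; [exact: cvg_cst|exact: cf]. Qed.

Lemma sin_two_pi : sin (2 * pi) = 0 :> R.
Proof. by rewrite mulrC mulr_natr sin2pi. Qed.

Lemma cos_two_pi : cos (2 * pi) = 1 :> R.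
Proof. by rewrite mulrC mulr_natr cos2pi. Qed.

Lemma circle_int_cos : circle_int (@cos R) = 0.
Proof.
apply: (circle_int_derive (@is_derive_sin R)); first exact: continuous_cos.
by rewrite sin_two_pi sin0.
Qed.

Lemma circle_int_sin : circle_int (@sin R) = 0.
Proof.
have d t : is_derive t 1 (fun t => -1 * cos t) (sin t : R).
  have := is_derive_mul (is_derive_const (-1) t) (is_derive_cos t).
  by rewrite mul0r add0r mulrNN mul1r.
apply: (circle_int_derive d); first exact: continuous_sin.
by rewrite cos_two_pi cos0.
Qed.

Lemma circle_int_sincos : circle_int (fun t : R => sin t * cos t) = 0.
Proof.
have d t : is_derive t 1 (fun t => 2^-1 * (sin t * sin t)) (sin t * cos t : R).
  have /= := is_derive_mul (is_derive_const 2^-1 t)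
    (is_derive_mul (is_derive_sin t) (is_derive_sin t)).
  by congr is_derive; field.
apply: (circle_int_derive d).
- exact: (continuous_mul (@continuous_sin R) (@continuous_cos R)).
- by rewrite sin_two_pi sin0.
Qed.

Lemma circle_int_cos2_sin2 :
  circle_int (fun t : R => cos t * cos t) = pi /\ circle_int (fun t : R => sin t * sin t) = pi.
Proof.
have cc := continuous_mul (@continuous_cos R) (@continuous_cos R).
have css := continuous_mul (@continuous_sin R) (@continuous_sin R).
have sumE : circle_int (fun t : R => cos t * cos t) + circle_int (fun t : R => sin t * sin t) = 2 * pi.
  rewrite -circle_intD// -[RHS]mulr1 -circle_int_cst; congr circle_int.
  by apply/funext => t; rewrite -!expr2 cos2Dsin2.
have difE : circle_int (fun t : R => cos t * cos t) + -1 * circle_int (fun t : R => sin t * sin t) = 0.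
  rewrite -circle_intZ// -circle_intD//; last exact: continuous_scale.
  have d t : is_derive t 1 (fun t => sin t * cos t)
      (cos t * cos t + -1 * (sin t * sin t) : R).
    have /= := is_derive_mul (is_derive_sin t) (is_derive_cos t).
    by congr is_derive; ring.
  apply: (circle_int_derive d).
  - exact (continuous_add cc (continuous_scale css)).
  - by rewrite sin_two_pi sin0 !mul0r.
by split; lra.
Qed.

(** [w r t] is a function in polar coordinates, allowed to take negative radii so
   that [r = 0] is an interior point; [wr], [wrr], [wt], [wtt] are its partial
   derivatives, and [polar_lap] is the polar form of the Laplace equation, which
   only involves pure second derivatives.  [polar_bounded] is the domination
   needed to differentiate integrals over the circle. *)
Record polar_harmonic (w wr wrr wt wtt : R -> R -> R) : Prop := PolarHarmonic {
  polar_r : forall r t, -1 < r < 1 -> is_derive r 1 (w^~ t) (wr r t) ;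
  polar_rr : forall r t, -1 < r < 1 -> is_derive r 1 (wr^~ t) (wrr r t) ;
  polar_t : forall r t, -1 < r < 1 -> is_derive t 1 (w r) (wt r t) ;
  polar_tt : forall r t, -1 < r < 1 -> is_derive t 1 (wt r) (wtt r t) ;
  polar_lap : forall r t, -1 < r < 1 -> r ^+ 2 * wrr r t + r * wr r t + wtt r t = 0 ;
  polar_cont_r : forall r, -1 < r < 1 -> continuous (wr r) ;
  polar_cont_rr : forall r, -1 < r < 1 -> continuous (wrr r) ;
  polar_bounded : forall b, 0 < b < 1 -> exists M, forall r t, -b < r < b ->
    0 <= t <= 2 * pi -> `|wr r t| <= M /\ `|wrr r t| <= M ;
  polar_per : forall r, -1 < r < 1 -> w r (2 * pi) = w r 0 ;
  polar_per_t : forall r, -1 < r < 1 -> wt r (2 * pi) = wt r 0 }.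

Section Moments.
Variables (w wr wrr wt wtt : R -> R -> R).
Hypothesis hw : polar_harmonic w wr wrr wt wtt.
Variables (g dg : R -> R) (l : R).
Hypothesis g_der : forall t, is_derive t 1 g (dg t).
Hypothesis dg_der : forall t, is_derive t 1 dg (- l * g t).
Hypothesis g_per : g (2 * pi) = g 0.
Hypothesis dg_per : dg (2 * pi) = dg 0.
Hypothesis g_le : exists M, forall t, `|g t| <= M.

Let A r := circle_int (fun t => w r t * g t).
Let A1 r := circle_int (fun t => wr r t * g t).
Let A2 r := circle_int (fun t => wrr r t * g t).

Let cg : continuous g.
Proof. by move=> t; exact: is_derive_continuous (g_der t). Qed.

Let cw r : -1 < r < 1 -> continuous (w r).
Proof. by move=> r1 t; exact: is_derive_continuous (polar_t hw _ r1). Qed.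

Let moment_bounded r : -1 < r < 1 -> exists b M, [/\ -b < r < b, 0 < b < 1 &
  forall x t, -b < x < b -> 0 <= t <= 2 * pi ->
    `|wr x t * g t| <= M /\ `|wrr x t * g t| <= M].
Proof.
move=> r1; have [N gN] := g_le.
have [|M wM] := @polar_bounded _ _ _ _ _ hw ((1 + `|r|) / 2).
  have : 0 <= `|r| < 1 by rewrite normr_ge0/= ltr_norml.
  by lra.
have : 0 <= `|r| < 1 by rewrite normr_ge0/= ltr_norml.
move=> absr; exists ((1 + `|r|) / 2), (M * N); split.
- by rewrite -ltr_norml; lra.
- by lra.
- move=> x t xb tpi; have [wrM wrrM] := wM x t xb tpi.
  by rewrite !normrM; split; apply: ler_pM.
Qed.

Let sub1 (b x : R) : 0 < b < 1 -> -b < x < b -> -1 < x < 1.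
Proof. by lra. Qed.

Lemma is_derive_moment r : -1 < r < 1 -> is_derive r 1 A (A1 r).
Proof.
move=> r1; have [b [M [rb b1 wM]]] := moment_bounded r1.
apply: (@is_derive_circle_int R _ (fun x t => wr x t * g t) r b M) => //.
- by move=> x xb; apply: continuous_mul => //; apply: cw; exact: sub1 xb.
- move=> x t xb.
  have := is_derive_mul (polar_r hw t (sub1 b1 xb)) (is_derive_const (g t) x).
  by rewrite mulr0 addr0.
- by move=> x t xb tpi; have [] := wM x t xb tpi.
Qed.

Lemma is_derive_moment1 r : -1 < r < 1 -> is_derive r 1 A1 (A2 r).
Proof.
move=> r1; have [b [M [rb b1 wM]]] := moment_bounded r1.
apply: (@is_derive_circle_int R _ (fun x t => wrr x t * g t) r b M) => //.
- move=> x xb; apply: continuous_mul => //.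
  by apply: (polar_cont_r hw); exact: sub1 xb.
- move=> x t xb.
  have := is_derive_mul (polar_rr hw t (sub1 b1 xb)) (is_derive_const (g t) x).
  by rewrite mulr0 addr0.
- by move=> x t xb tpi; have [] := wM x t xb tpi.
Qed.

(** Multiply the polar Laplace equation by [g] and integrate: two integrations by
   parts in [t] turn the integral of [wtt g] into that of [w g'' = - l w g]. *)
Lemma moment_ode r : -1 < r < 1 -> r ^+ 2 * A2 r + r * A1 r = l * A r.
Proof.
move=> r1.
have c1 := continuous_mul (polar_cont_r hw r1) cg.
have c2 := continuous_mul (polar_cont_rr hw r1) cg.
have c0 := continuous_mul (cw r1) cg.
apply/eqP; rewrite -subr_eq0 -mulNr; apply/eqP.
have k2 := continuous_scale (k := r ^+ 2) c2.
have k1 := continuous_scale (k := r) c1.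
have k0 := continuous_scale (k := - l) c0.
have k21 := continuous_add k2 k1.
rewrite /A /A1 /A2 -!circle_intZ// -!circle_intD//.
(* The Green identity: [(w g' - wt g)' = w g'' - wtt g]. *)
have d t : is_derive t 1 (fun t => -1 * (wt r t * g t) + w r t * dg t)
    (r ^+ 2 * (wrr r t * g t) + r * (wr r t * g t) + - l * (w r t * g t)).
  have := is_derive_add
    (is_derive_mul (is_derive_const (-1) t) (is_derive_mul (polar_tt hw t r1) (g_der t)))
    (is_derive_mul (polar_t hw t r1) (dg_der t)).
  congr is_derive => /=.
  by have := polar_lap hw t r1; move: (wtt r t) => x /(canRL (addrK _)); rewrite sub0r => e;
   rewrite -[x]opprK -e; ring.
apply: (circle_int_derive d).
- exact: continuous_add k21 k0.
- by rewrite (polar_per hw)// (polar_per_t hw)// g_per dg_per.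
Qed.

Let A_cont r : -1 < r < 1 -> {for r, continuous A}.
Proof. by move=> r1; exact: is_derive_continuous (is_derive_moment r1). Qed.

Let A1_cont r : -1 < r < 1 -> {for r, continuous A1}.
Proof. by move=> r1; exact: is_derive_continuous (is_derive_moment1 r1). Qed.

(** For [l = 0] the equation says [(r A')' = 0], so [r A'], which vanishes at the
   centre, is zero. *)
Lemma moment0 r : l = 0 -> 0 < r < 1 -> A r = A 0.
Proof.
move=> l0 r1.
have rA1 x : 0 < x < 1 -> x * A1 x = 0.
  move=> x1; have -> : 0 = 0 * A1 0 :> R by rewrite mul0r.
  apply: (@derive_cst_on R (fun y => y * A1 y)) => [|y y1|y y1]; first lra.
  - by apply: cvgM; [exact: cvg_id|apply: A1_cont; lra].
  - have y1' : -1 < y < 1 by lra.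
    have := is_derive_mul (is_derive_id y 1) (is_derive_moment1 y1').
    congr is_derive => /=; apply: (@mulfI _ y); first by rewrite gt_eqF//; lra.
    by rewrite mulr0 -(mul0r (A y)) -l0 -moment_ode//; ring.
apply: derive_cst_on => [|x x1|x x1]; first lra.
- by apply: A_cont; lra.
- have -> : 0 = A1 x.
    have x1' : 0 < x < 1 by lra.
    by have /eqP := rA1 x x1'; rewrite mulf_eq0 gt_eqF/= => [/eqP|] //; lra.
  by apply: is_derive_moment; lra.
Qed.

(** For [l = 1] the equation says [(r (r A' - A))' = 0], so [r A' = A]; this rules
   out the singular solution [1 / r]. *)
Lemma moment1 r : l = 1 -> 0 < r < 1 -> A r = r * A1 0.
Proof.
move=> l1 r1.
have rA1 x : 0 < x < 1 -> x * A1 x = A x.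
  move=> x1; apply: (@mulfI _ x); first by rewrite gt_eqF//; lra.
  apply/eqP; rewrite -subr_eq0 -mulrN -mulrDr; apply/eqP.
  have -> : 0 = 0 * (0 * A1 0 - A 0) :> R by rewrite mul0r.
  apply: (@derive_cst_on R (fun y => y * (y * A1 y - A y))) => [|y y1|y y1]; first lra.
  - apply: cvgM; first exact: cvg_id.
    apply: cvgB; last by apply: A_cont; lra.
    by apply: cvgM; [exact: cvg_id|apply: A1_cont; lra].
  - have y1' : -1 < y < 1 by lra.
    have dA := is_derive_moment y1'; have dA1 := is_derive_moment1 y1'.
    have := is_derive_mul (is_derive_id y 1) (is_derive_add
      (is_derive_mul (is_derive_id y 1) dA1)
      (is_derive_mul (is_derive_const (-1) y) dA)).
    under [X in is_derive _ _ X _ -> _]eq_fun do rewrite mulN1r.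
    congr is_derive => /=.
    by have := moment_ode y1'; rewrite l1 mul1r => <-; ring.
(* Differentiating [x * A1 x = A x] gives [x * A2 x = 0]. *)
have A1_cst : A1 r = A1 0.
  apply: derive_cst_on => [|x x1|x x1]; first lra.
  - by apply: A1_cont; lra.
  - have x1' : -1 < x < 1 by lra.
    have := is_derive_moment1 x1'; congr is_derive.
    apply: (@mulfI _ x); first by rewrite gt_eqF//; lra.
    apply: (@mulfI _ x); first by rewrite gt_eqF//; lra.
    have x01 : 0 < x < 1 by lra.
    have := moment_ode x1'; rewrite l1 mul1r -rA1// => e.
    by rewrite !mulr0 mulrA -expr2; lra.
by rewrite -A1_cst rA1.
Qed.

End Moments.
End PolarHarmonic.

(** * Scalar functions along plane curves *)

Section PlaneCurves.
Context {R : realType}.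
Implicit Types (u p q : R * R -> R) (z : R * R).

Lemma is_derive_inv (f : R -> R) (df x : R) : f x != 0 -> is_derive x 1 f df ->
  is_derive x 1 (fun y => (f y)^-1) (- df / f x ^+ 2).
Proof.
move=> fx0 [df' dfE]; split; first exact: derivableV.
by rewrite deriveV// dfE -exprVn /GRing.scale/= mulNr mulNr mulrC.
Qed.

Lemma is_derive_comp_curve u z (c1 c2 : R -> R) (x d1 d2 a b : R) :
  (c1 x, c2 x) = z -> is_derive x 1 c1 d1 -> is_derive x 1 c2 d2 ->
  is_diff z u (fun v => v.1 * a + v.2 * b) ->
  is_derive x 1 (fun y => u (c1 y, c2 y)) (d1 * a + d2 * b).
Proof.
move=> <- [c1' c1E] [c2' c2E] du.
have dc1 : is_diff x c1 ( *:%R^~ d1).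
  by split; [exact/derivable1_diffP|rewrite deriv1E// derive1E c1E].
have dc2 : is_diff x c2 ( *:%R^~ d2).
  by split; [exact/derivable1_diffP|rewrite deriv1E// derive1E c2E].
have dc := @is_diff_pair _ _ _ _ _ _ _ _ _ dc1 dc2.
have [du' duE] := @is_diff_comp _ _ _ _ _ _ _ _ _ dc du.
split; first exact/derivable1_diffP.
by rewrite deriveE// duE/= !scale1r.
Qed.

(** [u] with its gradient [(p, q)] and the Hessian entries [p1 p2 q1 q2].  Along
   conformal curves the mixed entries [p2], [q1] cancel in the polar Laplacian,
   whether or not they agree. *)
Record harmonic_jet (D : set (R * R)) u p q (p1 p2 q1 q2 : R * R -> R) : Prop := HarmonicJet {
  jet_u : forall z, D z -> is_diff z u (fun v => v.1 * p z + v.2 * q z) ;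
  jet_p : forall z, D z -> is_diff z p (fun v => v.1 * p1 z + v.2 * p2 z) ;
  jet_q : forall z, D z -> is_diff z q (fun v => v.1 * q1 z + v.2 * q2 z) ;
  jet_p1 : forall z, D z -> {for z, continuous p1} ;
  jet_p2 : forall z, D z -> {for z, continuous p2} ;
  jet_q1 : forall z, D z -> {for z, continuous q1} ;
  jet_q2 : forall z, D z -> {for z, continuous q2} ;
  jet_lap : forall z, D z -> p1 z + q2 z = 0 }.

(** Continuity in both polar coordinates over the disk.  It is stable under the
   operations building the map below, and yields both continuity on each circle
   and the uniform bounds asked by [polar_bounded]. *)
Definition jointly_continuous (f : R -> R -> R) := forall r t, -1 < r < 1 ->
  {for (r, t), continuous (fun x : R * R => f x.1 x.2)}.

Lemma jointly_continuousD f g : jointly_continuous f -> jointly_continuous g ->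
  jointly_continuous (fun r t => f r t + g r t).
Proof. by move=> cf cg r t r1; apply: cvgD; [exact: cf|exact: cg]. Qed.

Lemma jointly_continuousM f g : jointly_continuous f -> jointly_continuous g ->
  jointly_continuous (fun r t => f r t * g r t).
Proof. by move=> cf cg r t r1; apply: cvgM; [exact: cf|exact: cg]. Qed.

Lemma jointly_continuousN f : jointly_continuous f -> jointly_continuous (fun r t => - f r t).
Proof. by move=> cf r t r1; apply: cvgN; exact: cf. Qed.

Lemma jointly_continuousV f : jointly_continuous f -> (forall r t, -1 < r < 1 -> f r t != 0) ->
  jointly_continuous (fun r t => (f r t)^-1).
Proof. by move=> cf f0 r t r1; apply: cvgV; [exact: f0|exact: cf]. Qed.

Lemma jointly_continuous_cst k : jointly_continuous (fun _ _ => k).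
Proof. by move=> r t r1; exact: cvg_cst. Qed.

Lemma jointly_continuous_radius : jointly_continuous (fun r _ => r).
Proof. by move=> r t r1; exact: cvg_fst. Qed.

Lemma jointly_continuous_angle (g : R -> R) : continuous g -> jointly_continuous (fun _ t => g t).
Proof.
by move=> cg r t r1; apply: (@continuous_comp _ _ _ snd g); [exact: cvg_snd|exact: cg].
Qed.

Lemma jointly_continuous_comp u f g : jointly_continuous f -> jointly_continuous g ->
  (forall r t, -1 < r < 1 -> {for (f r t, g r t), continuous u}) ->
  jointly_continuous (fun r t => u (f r t, g r t)).
Proof.
move=> cf cg cu r t r1.
apply: (@continuous_comp _ _ _ (fun x : R * R => (f x.1 x.2, g x.1 x.2)) u).
  have cf' := cf r t r1; have cg' := cg r t r1.
  exact: (cvg_pair cf' cg').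
exact: cu.
Qed.

Lemma jointly_continuous_circle f r : jointly_continuous f -> -1 < r < 1 -> continuous (f r).
Proof.
move=> cf r1 t.
apply: (@continuous_comp _ _ _ (fun t => (r, t)) (fun x : R * R => f x.1 x.2)).
  by apply: (@cvg_pair _ _ _ _ (nbhs r) (nbhs t)); [exact: cvg_cst|exact: cvg_id].
exact: cf.
Qed.

Lemma jointly_continuous_bounded f b : jointly_continuous f -> 0 < b < 1 ->
  exists M, forall r t, -b < r < b -> 0 <= t <= 2 * pi -> `|f r t| <= M.
Proof.
move=> cf b1.
pose A : set (R * R) := `[-b, b]%classic `*` `[0, 2 * pi]%classic.
have cA : compact A by apply: compact_setX; exact: segment_compact.
have A0 : A !=set0.
  by exists (0, 0); split; rewrite /= in_itv/=; [lra|rewrite lexx/= ltW// mulr_gt0 ?pi_gt0].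
have cfA : {within A, continuous (fun x : R * R => `|f x.1 x.2|)}.
  apply/continuous_in_subspaceT => -[r t]; rewrite inE/= => -[]/=; rewrite !in_itv/= => rb _.
  by apply: cvg_norm; apply: cf; lra.
have [c _ cM] := compact_EVT_max A0 cA cfA.
exists `|f c.1 c.2| => r t rb tpi.
by apply: (cM (r, t)); rewrite inE; split; rewrite /= in_itv/=; lra.
Qed.

End PlaneCurves.

(** * A Moebius map centred at a given point *)

Section Mobius.
Context {R : realType}.
Variables (a b e1 e2 : R).
Hypothesis z_disk : a ^+ 2 + b ^+ 2 < 1.
Hypothesis e_unit : e1 ^+ 2 + e2 ^+ 2 = 1.

(* Real and imaginary parts of complex quantities.  With [z0 = a + i b] and
   [e = e1 + i e2] these are
     [E = e exp(i t)], [P = conj z0 * E], [Q = 1 + r P], [N = |Q|^2],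
     [M = 1 / Q], [S = M^2], [T = P M],
   and the map in polar coordinates is [mobius = z0 + k r E M], which equals
   [(m + z0) / (1 + conj z0 m)] for [m = r E].  Its radial derivatives are
   [X = k E S] and [Y = - 2 X T]. *)
Let k : R := 1 - (a ^+ 2 + b ^+ 2).
Let E1 (t : R) : R := e1 * cos t - e2 * sin t.
Let E2 (t : R) : R := e2 * cos t + e1 * sin t.
Let P1 (t : R) : R := a * E1 t + b * E2 t.
Let P2 (t : R) : R := a * E2 t - b * E1 t.
Let Q1 (r t : R) : R := 1 + r * P1 t.
Let Q2 (r t : R) : R := r * P2 t.
Let N (r t : R) : R := Q1 r t * Q1 r t + Q2 r t * Q2 r t.
Let M1 (r t : R) : R := Q1 r t * (N r t)^-1.
Let M2 (r t : R) : R := - (Q2 r t * (N r t)^-1).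
Let S1 (r t : R) : R := M1 r t * M1 r t - M2 r t * M2 r t.
Let S2 (r t : R) : R := M1 r t * M2 r t + M2 r t * M1 r t.

Definition mobius1 (r t : R) : R := a + k * (r * (E1 t * M1 r t - E2 t * M2 r t)).
Definition mobius2 (r t : R) : R := b + k * (r * (E1 t * M2 r t + E2 t * M1 r t)).
Let X1 (r t : R) : R := k * (E1 t * S1 r t - E2 t * S2 r t).
Let X2 (r t : R) : R := k * (E1 t * S2 r t + E2 t * S1 r t).
Let T1 (r t : R) : R := P1 t * M1 r t - P2 t * M2 r t.
Let T2 (r t : R) : R := P1 t * M2 r t + P2 t * M1 r t.
Let Y1 (r t : R) : R := - 2 * (X1 r t * T1 r t - X2 r t * T2 r t).
Let Y2 (r t : R) : R := - 2 * (X1 r t * T2 r t + X2 r t * T1 r t).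

Let E_unit (t : R) : E1 t ^+ 2 + E2 t ^+ 2 = 1.
Proof.
rewrite -[RHS](mulr1 1) -{1}e_unit -(cos2Dsin2 t) /E1 /E2; ring.
Qed.

(** By Cauchy-Schwarz [|P| < 1], so [Q] has positive real part. *)
Let Q1_gt0 (r t : R) : -1 < r < 1 -> 0 < Q1 r t.
Proof.
move=> r1.
have P1lt : P1 t ^+ 2 < 1.
  apply: le_lt_trans z_disk.
  rewrite -[leRHS]mulr1 -(E_unit t) /P1 -subr_ge0.
  have -> : (a ^+ 2 + b ^+ 2) * (E1 t ^+ 2 + E2 t ^+ 2) -
    (a * E1 t + b * E2 t) ^+ 2 = (a * E2 t - b * E1 t) ^+ 2 by ring.
  exact: sqr_ge0.
have /andP[P1l P1r] : -1 < P1 t < 1.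
  by rewrite -ltr_norml -(@expr_lt1 _ 2)// real_normK ?num_real.
case/andP: r1 => rl rr; rewrite /Q1.
have : 0 < (1 + r) * (1 + P1 t) by rewrite mulr_gt0//; lra.
have : 0 < (1 - r) * (1 - P1 t) by rewrite mulr_gt0//; lra.
lra.
Qed.

Let N_gt0 (r t : R) : -1 < r < 1 -> 0 < N r t.
Proof.
move=> r1; have := Q1_gt0 t r1; rewrite /N => h.
by rewrite ltr_pwDl ?mulr_gt0// -expr2 sqr_ge0.
Qed.

Let MQ1 (r t : R) : -1 < r < 1 -> M1 r t * Q1 r t - M2 r t * Q2 r t = 1.
Proof.
move=> r1; have := lt0r_neq0 (N_gt0 t r1); rewrite /M1 /M2 => n0.
have -> : Q1 r t * (N r t)^-1 * Q1 r t - - (Q2 r t * (N r t)^-1) * Q2 r t =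
  N r t * (N r t)^-1 by rewrite /N; ring.
by rewrite divff.
Qed.

Let MQ2 (r t : R) : M1 r t * Q2 r t + M2 r t * Q1 r t = 0.
Proof. by rewrite /M1 /M2; ring. Qed.

(** From [mobius * Q = z0 + r E] and
   [|Q|^2 - |z0 + r E|^2 = (1 - |z0|^2) (1 - r^2)]. *)
Lemma mobius_disk (r t : R) : -1 < r < 1 -> mobius1 r t ^+ 2 + mobius2 r t ^+ 2 < 1.
Proof.
move=> r1; have n0 := N_gt0 t r1; have q1 := MQ1 t r1; have q2 := MQ2 r t.
have h1 : mobius1 r t * Q1 r t - mobius2 r t * Q2 r t = a + r * E1 t.
  transitivity (a * Q1 r t - b * Q2 r t + k * r *
    (E1 t * (M1 r t * Q1 r t - M2 r t * Q2 r t) -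
     E2 t * (M1 r t * Q2 r t + M2 r t * Q1 r t))).
    by rewrite /mobius1 /mobius2; ring.
  rewrite q1 q2 /Q1 /Q2 /P1 /P2 /k; ring.
have h2 : mobius1 r t * Q2 r t + mobius2 r t * Q1 r t = b + r * E2 t.
  transitivity (a * Q2 r t + b * Q1 r t + k * r *
    (E2 t * (M1 r t * Q1 r t - M2 r t * Q2 r t) +
     E1 t * (M1 r t * Q2 r t + M2 r t * Q1 r t))).
    by rewrite /mobius1 /mobius2; ring.
  rewrite q1 q2 /Q1 /Q2 /P1 /P2 /k; ring.
rewrite -(ltr_pM2r n0) mul1r -subr_gt0.
have -> : N r t - (mobius1 r t ^+ 2 + mobius2 r t ^+ 2) * N r t =
   N r t - ((mobius1 r t * Q1 r t - mobius2 r t * Q2 r t) ^+ 2 +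
           (mobius1 r t * Q2 r t + mobius2 r t * Q1 r t) ^+ 2).
  by rewrite /N; ring.
rewrite h1 h2.
have -> : N r t - ((a + r * E1 t) ^+ 2 + (b + r * E2 t) ^+ 2) = k * (1 - r ^+ 2).
  transitivity (1 - (a ^+ 2 + b ^+ 2) + r ^+ 2 *
    ((a ^+ 2 + b ^+ 2) * (E1 t ^+ 2 + E2 t ^+ 2) - (E1 t ^+ 2 + E2 t ^+ 2))).
    by rewrite /N /Q1 /Q2 /P1 /P2; ring.
  by rewrite E_unit /k; ring.
rewrite mulr_gt0 /k ?subr_gt0//.
by rewrite -real_normK ?num_real// expr_lt1// ltr_norml.
Qed.

Let is_derive_E1 (t : R) : is_derive t 1 E1 (- E2 t).
Proof.
have := is_derive_add (is_derive_mul (is_derive_const e1 t) (is_derive_cos t))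
  (is_derive_mul (is_derive_const (- e2) t) (is_derive_sin t)).
rewrite /E1; under [X in is_derive _ _ X _ -> _]eq_fun do rewrite mulNr.
by congr is_derive; rewrite /E2; ring.
Qed.

Let is_derive_E2 (t : R) : is_derive t 1 E2 (E1 t).
Proof.
have := is_derive_add (is_derive_mul (is_derive_const e2 t) (is_derive_cos t))
  (is_derive_mul (is_derive_const e1 t) (is_derive_sin t)).
by congr is_derive; rewrite /E1; ring.
Qed.

(** Any curve [q = (q1, q2)] in the punctured plane has
   [(1/q)' = - q' / q ^ 2]. *)
Let is_derive_crecip (q1 q2 : R -> R) (x d1 d2 : R) :
  let n y := q1 y * q1 y + q2 y * q2 y in
  let m1 y := q1 y * (n y)^-1 in
  let m2 y := - (q2 y * (n y)^-1) in
  n x != 0 -> is_derive x 1 q1 d1 -> is_derive x 1 q2 d2 ->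
  is_derive x 1 m1 (- (d1 * (m1 x * m1 x - m2 x * m2 x) - d2 * (m1 x * m2 x + m2 x * m1 x))) /\
  is_derive x 1 m2 (- (d1 * (m1 x * m2 x + m2 x * m1 x) + d2 * (m1 x * m1 x - m2 x * m2 x))).
Proof.
move=> n m1 m2 n0 h1 h2.
have hn := is_derive_inv n0 (is_derive_add (is_derive_mul h1 h1) (is_derive_mul h2 h2)).
split.
- have := is_derive_mul h1 hn; congr is_derive; rewrite /m1 /m2 /n; field; exact: n0.
- have := is_derive_mul (is_derive_const (-1) x) (is_derive_mul h2 hn).
  rewrite /m2; under [X in is_derive _ _ X _ -> _]eq_fun do rewrite mulN1r.
  congr is_derive; rewrite /m1 /n; field; exact: n0.
Qed.

Let is_derive_P (t : R) : is_derive t 1 P1 (- P2 t) /\ is_derive t 1 P2 (P1 t).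
Proof.
split.
- have := is_derive_add (is_derive_mul (is_derive_const a t) (is_derive_E1 t))
    (is_derive_mul (is_derive_const b t) (is_derive_E2 t)).
  by congr is_derive; rewrite /P2; ring.
- have := is_derive_add (is_derive_mul (is_derive_const a t) (is_derive_E2 t))
    (is_derive_mul (is_derive_const (- b) t) (is_derive_E1 t)).
  rewrite /P2; under [X in is_derive _ _ X _ -> _]eq_fun do rewrite mulNr.
  by congr is_derive; rewrite /P1; ring.
Qed.

Let is_derive_M_r (r t : R) : -1 < r < 1 ->
  is_derive r 1 (M1^~ t) (- (P1 t * S1 r t - P2 t * S2 r t)) /\
  is_derive r 1 (M2^~ t) (- (P1 t * S2 r t + P2 t * S1 r t)).
Proof.
move=> r1; apply: is_derive_crecip; first exact: lt0r_neq0 (N_gt0 t r1).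
- have := is_derive_add (is_derive_const 1 r)
    (is_derive_mul (is_derive_id r 1) (is_derive_const (P1 t) r)).
  by congr is_derive; ring.
- have := is_derive_mul (is_derive_id r 1) (is_derive_const (P2 t) r).
  by congr is_derive; ring.
Qed.

Let is_derive_M_t (r t : R) : -1 < r < 1 ->
  is_derive t 1 (M1 r) (r * (P2 t * S1 r t + P1 t * S2 r t)) /\
  is_derive t 1 (M2 r) (- (r * (P1 t * S1 r t - P2 t * S2 r t))).
Proof.
move=> r1; have [dP1 dP2] := is_derive_P t.
have dQ1 : is_derive t 1 (Q1 r) (- (r * P2 t)).
  have := is_derive_add (is_derive_const 1 t) (is_derive_mul (is_derive_const r t) dP1).
  by congr is_derive; ring.
have dQ2 : is_derive t 1 (Q2 r) (r * P1 t).
  by have := is_derive_mul (is_derive_const r t) dP2; congr is_derive; ring.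
have [] := is_derive_crecip (lt0r_neq0 (N_gt0 t r1)) dQ1 dQ2.
by split; [move: a0|move: b0]; congr is_derive; rewrite /S1 /S2 /M1 /M2 /N; ring.
Qed.

(** [S Q = M], that is [M^2 = M - r P M^2]: this is what closes the derivative
   formulas of [mobius]. *)
Let SQ (r t : R) : -1 < r < 1 ->
  S1 r t * Q1 r t - S2 r t * Q2 r t = M1 r t /\ S1 r t * Q2 r t + S2 r t * Q1 r t = M2 r t.
Proof.
move=> r1; split; rewrite /S1 /S2.
- rewrite -[RHS]subr0 -[X in X - 0]mulr1 -{1}(MQ1 t r1) -(mulr0 (M2 r t)) -{1}(MQ2 r t); ring.
- rewrite -[RHS]addr0 -[X in X + 0]mulr1 -{1}(MQ1 t r1) -(mulr0 (M1 r t)) -{1}(MQ2 r t); ring.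
Qed.

Let is_derive_mobius_r (r t : R) : -1 < r < 1 ->
  is_derive r 1 (mobius1^~ t) (X1 r t) /\ is_derive r 1 (mobius2^~ t) (X2 r t).
Proof.
move=> r1; have [dM1 dM2] := is_derive_M_r t r1; have [s1 s2] := SQ t r1.
have d (c : R) : is_derive r 1 (fun=> c) 0 by exact: is_derive_const.
have did := is_derive_id r (1 : R).
split.
- have := is_derive_add (d a) (is_derive_mul (d k) (is_derive_mul did
    (is_derive_add (is_derive_mul (d (E1 t)) dM1) (is_derive_mul (d (- E2 t)) dM2)))).
  rewrite /mobius1; under [X in is_derive _ _ X _ -> _]eq_fun do rewrite mulNr.
  by congr is_derive; rewrite /X1 -s1 -s2 /Q1 /Q2; ring.
- have := is_derive_add (d b) (is_derive_mul (d k) (is_derive_mul did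
    (is_derive_add (is_derive_mul (d (E1 t)) dM2) (is_derive_mul (d (E2 t)) dM1)))).
  by congr is_derive; rewrite /X2 -s1 -s2 /Q1 /Q2; ring.
Qed.

(** The map is conformal: the angular derivative is [i r] times the radial one. *)
Let is_derive_mobius_t (r t : R) : -1 < r < 1 ->
  is_derive t 1 (mobius1 r) (- r * X2 r t) /\ is_derive t 1 (mobius2 r) (r * X1 r t).
Proof.
move=> r1; have [dM1 dM2] := is_derive_M_t t r1; have [s1 s2] := SQ t r1.
have d (c : R) : is_derive t 1 (fun=> c) 0 by exact: is_derive_const.
have dE1 := is_derive_E1 t; have dE2 := is_derive_E2 t.
split.
- have := is_derive_add (d a) (is_derive_mul (d k) (is_derive_mul (d r)
    (is_derive_add (is_derive_mul dE1 dM1)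
      (is_derive_mul (d (-1)) (is_derive_mul dE2 dM2))))).
  rewrite /mobius1; under [X in is_derive _ _ X _ -> _]eq_fun do rewrite mulN1r.
  by congr is_derive; rewrite /X2 -s1 -s2 /Q1 /Q2; ring.
- have := is_derive_add (d b) (is_derive_mul (d k) (is_derive_mul (d r)
    (is_derive_add (is_derive_mul dE1 dM2) (is_derive_mul dE2 dM1)))).
  by congr is_derive; rewrite /X1 -s1 -s2 /Q1 /Q2; ring.
Qed.

(** Derivative of [k f m^2] along any pair of complex curves [f], [m]; used
   with [f = E], [m = M] in both polar variables. *)
Let is_derive_X (x : R) (m1 m2 f1 f2 : R -> R) (dm1 dm2 df1 df2 : R) :
  let s1 y := m1 y * m1 y - m2 y * m2 y in
  let s2 y := m1 y * m2 y + m2 y * m1 y in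
  is_derive x 1 m1 dm1 -> is_derive x 1 m2 dm2 ->
  is_derive x 1 f1 df1 -> is_derive x 1 f2 df2 ->
  is_derive x 1 (fun y => k * (f1 y * s1 y - f2 y * s2 y))
    (k * (df1 * s1 x - df2 * s2 x + 2 * (f1 x * (m1 x * dm1 - m2 x * dm2)
       - f2 x * (m1 x * dm2 + m2 x * dm1)))) /\
  is_derive x 1 (fun y => k * (f1 y * s2 y + f2 y * s1 y))
    (k * (df1 * s2 x + df2 * s1 x + 2 * (f1 x * (m1 x * dm2 + m2 x * dm1)
       + f2 x * (m1 x * dm1 - m2 x * dm2)))).
Proof.
move=> s1 s2 dM1 dM2 dF1 dF2.
have d (c : R) : is_derive x 1 (fun=> c) 0 by exact: is_derive_const.
have dS1 : is_derive x 1 s1 (2 * (m1 x * dm1 - m2 x * dm2)).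
  have := is_derive_add (is_derive_mul dM1 dM1) (is_derive_mul (d (-1)) (is_derive_mul dM2 dM2)).
  rewrite /s1; under [X in is_derive _ _ X _ -> _]eq_fun do rewrite mulN1r.
  by congr is_derive; ring.
have dS2 : is_derive x 1 s2 (2 * (m1 x * dm2 + m2 x * dm1)).
  have := is_derive_add (is_derive_mul dM1 dM2) (is_derive_mul dM2 dM1).
  by congr is_derive; ring.
split.
- have := is_derive_mul (d k) (is_derive_add (is_derive_mul dF1 dS1)
    (is_derive_mul (d (-1)) (is_derive_mul dF2 dS2))).
  under [X in is_derive _ _ X _ -> _]eq_fun do rewrite mulN1r.
  by congr is_derive; ring.
- have := is_derive_mul (d k) (is_derive_add (is_derive_mul dF1 dS2) (is_derive_mul dF2 dS1)).
  by congr is_derive; ring.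
Qed.

Let is_derive_X_r (r t : R) : -1 < r < 1 ->
  is_derive r 1 (X1^~ t) (Y1 r t) /\ is_derive r 1 (X2^~ t) (Y2 r t).
Proof.
move=> r1; have [dM1 dM2] := is_derive_M_r t r1.
have [] := is_derive_X dM1 dM2 (is_derive_const (E1 t) r) (is_derive_const (E2 t) r).
by move=> h1 h2; split; [move: h1|move: h2]; congr is_derive;
  rewrite /Y1 /Y2 /X1 /X2 /T1 /T2 /S1 /S2; ring.
Qed.

Let is_derive_X_t (r t : R) : -1 < r < 1 ->
  is_derive t 1 (X1 r) (- (X2 r t + r * Y2 r t)) /\
  is_derive t 1 (X2 r) (X1 r t + r * Y1 r t).
Proof.
move=> r1; have [dM1 dM2] := is_derive_M_t t r1.
have [] := is_derive_X dM1 dM2 (is_derive_E1 t) (is_derive_E2 t).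
by move=> h1 h2; split; [move: h1|move: h2]; congr is_derive;
  rewrite /Y1 /Y2 /X1 /X2 /T1 /T2 /S1 /S2; ring.
Qed.

Let mobius_jointly_continuous : [/\ jointly_continuous mobius1, jointly_continuous mobius2,
  jointly_continuous X1 & jointly_continuous X2] /\
  (jointly_continuous Y1 /\ jointly_continuous Y2).
Proof.
have ccos := jointly_continuous_angle (@continuous_cos R).
have csin := jointly_continuous_angle (@continuous_sin R).
have cst (c : R) : jointly_continuous (fun _ _ => c) by exact: jointly_continuous_cst.
have cE1 : jointly_continuous (fun=> E1).
  by apply: jointly_continuousD;
    [exact: jointly_continuousM|
     apply: jointly_continuousN; exact: jointly_continuousM].
have cE2 : jointly_continuous (fun=> E2) by apply: jointly_continuousD; exact: jointly_continuousM.
have cP1 : jointly_continuous (fun=> P1) by apply: jointly_continuousD; exact: jointly_continuousM.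
have cP2 : jointly_continuous (fun=> P2).
  by apply: jointly_continuousD;
    [exact: jointly_continuousM|
     apply: jointly_continuousN; exact: jointly_continuousM].
have cr := @jointly_continuous_radius R.
have cQ1 : jointly_continuous Q1 by apply: jointly_continuousD => //; exact: jointly_continuousM.
have cQ2 : jointly_continuous Q2 by apply: jointly_continuousM.
have cN : jointly_continuous (fun r t => (N r t)^-1).
  apply: jointly_continuousV; first by apply: jointly_continuousD; exact: jointly_continuousM.
  by move=> r t r1; exact: lt0r_neq0 (N_gt0 t r1).
have cM1 : jointly_continuous M1 by exact: jointly_continuousM.
have cM2 : jointly_continuous M2 by apply: jointly_continuousN; exact: jointly_continuousM.
have cS1 : jointly_continuous S1.
  by apply: jointly_continuousD;
    [exact: jointly_continuousM|
     apply: jointly_continuousN; exact: jointly_continuousM].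
have cS2 : jointly_continuous S2 by apply: jointly_continuousD; exact: jointly_continuousM.
have cT1 : jointly_continuous T1.
  by apply: jointly_continuousD;
    [exact: jointly_continuousM|
     apply: jointly_continuousN; exact: jointly_continuousM].
have cT2 : jointly_continuous T2 by apply: jointly_continuousD; exact: jointly_continuousM.
have cX1 : jointly_continuous X1.
  apply: jointly_continuousM; first exact: cst.
  by apply: jointly_continuousD;
    [exact: jointly_continuousM|
     apply: jointly_continuousN; exact: jointly_continuousM].
have cX2 : jointly_continuous X2.
  by apply: jointly_continuousM; [exact: cst|apply: jointly_continuousD; exact: jointly_continuousM].
split; [split=> //|split].
- apply: jointly_continuousD; first exact: cst.
  apply: jointly_continuousM; first exact: cst.
  apply: jointly_continuousM; first exact: cr.
  by apply: jointly_continuousD;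
    [exact: jointly_continuousM|
     apply: jointly_continuousN; exact: jointly_continuousM].
- apply: jointly_continuousD; first exact: cst.
  apply: jointly_continuousM; first exact: cst.
  apply: jointly_continuousM; first exact: cr.
  by apply: jointly_continuousD; exact: jointly_continuousM.
- apply: jointly_continuousM; first exact: cst.
  by apply: jointly_continuousD;
    [exact: jointly_continuousM|
     apply: jointly_continuousN; exact: jointly_continuousM].
- apply: jointly_continuousM; first exact: cst.
  by apply: jointly_continuousD; exact: jointly_continuousM.
Qed.

Let mobius_per (r : R) : [/\ mobius1 r (2 * pi) = mobius1 r 0, mobius2 r (2 * pi) = mobius2 r 0,
  X1 r (2 * pi) = X1 r 0 & X2 r (2 * pi) = X2 r 0].
Proof.
have E1p : E1 (2 * pi) = E1 0 by rewrite /E1 cos_two_pi sin_two_pi cos0 sin0.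
have E2p : E2 (2 * pi) = E2 0 by rewrite /E2 cos_two_pi sin_two_pi cos0 sin0.
by split; rewrite /mobius1 /mobius2 /X1 /X2 /S1 /S2 /M1 /M2 /N /Q1 /Q2 /P1 /P2 E1p E2p.
Qed.

Variables (u p q p1 p2 q1 q2 : R * R -> R).
Hypothesis hu : harmonic_jet (@unit_disk R) u p q p1 p2 q1 q2.

Let c (r t : R) : R * R := (mobius1 r t, mobius2 r t).

Let c_disk (r t : R) : -1 < r < 1 -> unit_disk R (c r t).
Proof.
move=> r1; rewrite /unit_disk/= /eucl/= -sqrtr1 ltr_sqrt//.
exact: mobius_disk.
Qed.

(* Chain rule for [u o mobius].  As [mobius] has radial derivatives [X], [Y] and
   angular derivatives [i r X] and [- r X - r^2 Y], the combination
   [r^2 wrr + r wr + wtt] reduces to [r^2 |X|^2 (p1 + q2) = 0]. *)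
Let w r t := u (c r t).
Let wr r t := X1 r t * p (c r t) + X2 r t * q (c r t).
Let wrr r t := (Y1 r t * p (c r t) + X1 r t * (X1 r t * p1 (c r t) + X2 r t * p2 (c r t)))
  + (Y2 r t * q (c r t) + X2 r t * (X1 r t * q1 (c r t) + X2 r t * q2 (c r t))).
Let wt r t := r * (X1 r t * q (c r t) + (-1) * (X2 r t * p (c r t))).
Let wtt r t := r * (- (X2 r t + r * Y2 r t) * q (c r t) +
    X1 r t * (- r * X2 r t * q1 (c r t) + r * X1 r t * q2 (c r t)) +
  (-1) * ((X1 r t + r * Y1 r t) * p (c r t) +
    X2 r t * (- r * X2 r t * p1 (c r t) + r * X1 r t * p2 (c r t)))).

Lemma mobius_polar_harmonic : polar_harmonic w wr wrr wt wtt.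
Proof.
have [[cm1 cm2 cX1 cX2] [cY1 cY2]] := mobius_jointly_continuous.
have jcu v : (forall z, unit_disk R z -> {for z, continuous v}) ->
    jointly_continuous (fun r t => v (c r t)).
  by move=> cv; apply: (jointly_continuous_comp cm1 cm2) => r t r1; apply: cv; exact: c_disk.
have cp : jointly_continuous (fun r t => p (c r t)).
  apply: jcu => z Dz; have [dp _] := jet_p hu Dz; exact: differentiable_continuous.
have cq : jointly_continuous (fun r t => q (c r t)).
  apply: jcu => z Dz; have [dp _] := jet_q hu Dz; exact: differentiable_continuous.
have cp1 := jcu _ (jet_p1 hu); have cp2 := jcu _ (jet_p2 hu).
have cq1 := jcu _ (jet_q1 hu); have cq2 := jcu _ (jet_q2 hu).
have cwr : jointly_continuous wr by apply: jointly_continuousD; exact: jointly_continuousM.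
have cwrr : jointly_continuous wrr.
  apply: jointly_continuousD; apply: jointly_continuousD; try exact: jointly_continuousM.
    by apply: jointly_continuousM => //; apply: jointly_continuousD; exact: jointly_continuousM.
  by apply: jointly_continuousM => //; apply: jointly_continuousD; exact: jointly_continuousM.
split.
- move=> r t r1; have [d1 d2] := is_derive_mobius_r t r1.
  exact: (is_derive_comp_curve erefl d1 d2 (jet_u hu (c_disk t r1))).
- move=> r t r1; have [d1 d2] := is_derive_mobius_r t r1.
  have [dX1 dX2] := is_derive_X_r t r1.
  exact: (is_derive_add
   (is_derive_mul dX1 (is_derive_comp_curve erefl d1 d2 (jet_p hu (c_disk t r1))))
   (is_derive_mul dX2 (is_derive_comp_curve erefl d1 d2 (jet_q hu (c_disk t r1))))).
- move=> r t r1; have [d1 d2] := is_derive_mobius_t t r1.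
  have := is_derive_comp_curve erefl d1 d2 (jet_u hu (c_disk t r1)).
  by congr is_derive; rewrite /wt /c; ring.
- move=> r t r1; have [d1 d2] := is_derive_mobius_t t r1.
  have [dX1 dX2] := is_derive_X_t t r1.
  have := is_derive_mul (is_derive_const r t) (is_derive_add
   (is_derive_mul dX1 (is_derive_comp_curve erefl d1 d2 (jet_q hu (c_disk t r1))))
   (is_derive_mul (is_derive_const (-1) t)
   (is_derive_mul dX2 (is_derive_comp_curve erefl d1 d2 (jet_p hu (c_disk t r1)))))).
  by congr is_derive; rewrite /wtt /c !mul0r !add0r.
- move=> r t r1; have := jet_lap hu (c_disk t r1) => /eqP; rewrite addr_eq0 => /eqP p1E.
  by rewrite /wrr /wr /wtt p1E; ring.
- by move=> r r1; exact: jointly_continuous_circle.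
- by move=> r r1; exact: jointly_continuous_circle.
- move=> l l1; have [Ma wrM] := jointly_continuous_bounded cwr l1.
  have [Mb wrrM] := jointly_continuous_bounded cwrr l1.
  exists (Num.max Ma Mb) => r t rl tpi.
  by rewrite !le_max wrM// wrrM// orbT.
- by move=> r r1; rewrite /w /c; have [-> -> _ _] := mobius_per r.
- by move=> r r1; rewrite /wt /c; have [-> -> -> ->] := mobius_per r.
Qed.

Let X_0 t : X1 0 t = k * E1 t /\ X2 0 t = k * E2 t.
Proof.
have m1 : M1 0 t = 1 by rewrite /M1 /N /Q1 /Q2 !mul0r !addr0 !mulr1 divr1.
have m2 : M2 0 t = 0 by rewrite /M2 /Q2 !mul0r oppr0.
by rewrite /X1 /X2 /S1 /S2 m1 m2; split; ring.
Qed.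

Let mobius1_0 t : mobius1 0 t = a.
Proof. by rewrite /mobius1 mul0r mulr0 addr0. Qed.

Let mobius2_0 t : mobius2 0 t = b.
Proof. by rewrite /mobius2 mul0r mulr0 addr0. Qed.

(** The mean value property and its first-order analogue, at an arbitrary point of
   the disk: [(e1, e2)] is the direction of the source corresponding to [t = 0],
   and [k] is the conformal factor of the map at the origin. *)
Lemma harmonic_pairing (r al0 al1 al2 : R) : 0 < r < 1 ->
  let g t := al0 + (al1 * cos t + al2 * sin t) in
  continuous (fun t => u (mobius1 r t, mobius2 r t) * g t) /\
  circle_int (fun t => u (mobius1 r t, mobius2 r t) * g t) =
    2 * pi * (al0 * u (a, b)) + pi * (r * (k *
      (al1 * (e1 * p (a, b) + e2 * q (a, b)) +
       al2 * (- e2 * p (a, b) + e1 * q (a, b))))).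
Proof.
move=> r01 g; have hw := mobius_polar_harmonic.
have r1 : -1 < r < 1 by lra.
have cw : continuous (w r) by move=> t; exact: is_derive_continuous (polar_t hw t r1).
pose h t : R := al1 * cos t + al2 * sin t; pose dh t : R := al2 * cos t + - al1 * sin t.
have dhE (t : R) : is_derive t 1 h (dh t).
  have := is_derive_add (is_derive_mul (is_derive_const al1 t) (is_derive_cos t))
    (is_derive_mul (is_derive_const al2 t) (is_derive_sin t)).
  by congr is_derive; rewrite /dh; ring.
have ddhE (t : R) : is_derive t 1 dh (- 1 * h t).
  have := is_derive_add (is_derive_mul (is_derive_const al2 t) (is_derive_cos t))
    (is_derive_mul (is_derive_const (- al1) t) (is_derive_sin t)).
  by congr is_derive; rewrite /h; ring.
have h_per : h (2 * pi) = h 0 by rewrite /h cos_two_pi sin_two_pi cos0 sin0.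
have dh_per : dh (2 * pi) = dh 0 by rewrite /dh cos_two_pi sin_two_pi cos0 sin0.
have h_le : exists M, forall t, `|h t| <= M.
  exists (`|al1| + `|al2|) => t.
  rewrite /h (le_trans (ler_normD _ _))// !normrM lerD// ler_piMr// ler_norml.
    by rewrite cos_geN1 cos_le1.
  by rewrite sin_geN1 sin_le1.
have ch : continuous h by move=> t; exact: is_derive_continuous (dhE t).
have cwh := continuous_mul cw ch.
have cwc := continuous_scale (k := al0) cw.
have gE : (fun t => u (mobius1 r t, mobius2 r t) * g t) = (fun t => al0 * w r t + w r t * h t).
  by apply/funext => t; rewrite /w /c /g /h; ring.
split; first by rewrite gE; exact: continuous_add.
rewrite gE circle_intD// circle_intZ//; congr (_ + _).
  have d1 (t : R) : is_derive t 1 (fun=> 1 : R) 0 by exact: is_derive_const.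
  have d0 (t : R) : is_derive t 1 (fun=> 0 : R) (- 0 * 1).
    by rewrite oppr0 mul0r; exact: is_derive_const.
  have b1 : exists M : R, forall t : R, `|1 : R| <= M by exists 1 => _; rewrite normr1.
  have /= := @moment0 R _ _ _ _ _ hw (fun=> 1) (fun=> 0) 0 d1 d0 erefl erefl b1 r erefl r01.
  have -> : (fun t => w r t * 1) = w r by apply/funext => t; rewrite mulr1.
  have -> : (fun t => w 0 t * 1) = (fun=> u (a, b)).
    by apply/funext => t; rewrite mulr1 /w /c mobius1_0 mobius2_0.
  by move=> ->; rewrite circle_int_cst; ring.
rewrite (@moment1 R _ _ _ _ _ hw h dh 1 dhE ddhE h_per dh_per h_le r erefl r01).
set A := e1 * p (a, b) + _; set B := - e2 * p (a, b) + _.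
have -> : (fun t => wr 0 t * h t) = (fun t => k * (al1 * A) * (cos t * cos t) +
    (k * (al2 * A + al1 * B) * (sin t * cos t) + k * (al2 * B) * (sin t * sin t))).
  apply/funext => t; rewrite /wr /c mobius1_0 mobius2_0.
  by have [-> ->] := X_0 t; rewrite /E1 /E2 /h /A /B; ring.
have ccc := continuous_mul (@continuous_cos R) (@continuous_cos R).
have csc := continuous_mul (@continuous_sin R) (@continuous_cos R).
have css := continuous_mul (@continuous_sin R) (@continuous_sin R).
have [ic2 is2] := @circle_int_cos2_sin2 R.
have kcc := continuous_scale (k := k * (al1 * A)) ccc.
have ksc := continuous_scale (k := k * (al2 * A + al1 * B)) csc.
have kss := continuous_scale (k := k * (al2 * B)) css.
have ks := continuous_add ksc kss.
by rewrite !circle_intD// !circle_intZ// ic2 is2 circle_int_sincos; ring.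
Qed.

End Mobius.

(** * The inner product and the components of a harmonic map *)

Section InnerProduct.
Context {R : realType} {H : completeNormedModType R}.
Variable ip : {dot H for idfun}.
Hypothesis ip_norm : induces_norm ip.
Implicit Types x y : H.

Lemma ipC x y : ip x y = ip y x.
Proof. by rewrite hermC expr0 mul1r. Qed.

Lemma ipDl x y (z : H) : ip (x + y) z = ip x z + ip y z.
Proof. exact: linearDl. Qed.

Lemma ipZl k x (z : H) : ip (k *: x) z = k * ip x z.
Proof. exact: linearZl_LR. Qed.

Lemma ipDr x y (z : H) : ip x (y + z) = ip x y + ip x z.
Proof. by rewrite ipC ipDl !(ipC x). Qed.

Lemma ipZr k x (z : H) : ip x (k *: z) = k * ip x z.
Proof. by rewrite ipC ipZl ipC. Qed.

Lemma ipBl x y (z : H) : ip (x - y) z = ip x z - ip y z.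
Proof. by rewrite -scaleN1r ipDl ipZl mulN1r. Qed.

Lemma ip_ge0 x : 0 <= ip x x.
Proof.
have [->|x0] := eqVneq x 0; last by rewrite ltW// neq0_dnorm_gt0.
by have := ipZl 0 0 0; rewrite scale0r mul0r => ->.
Qed.

Lemma ip_sqr_norm x : ip x x = `|x| ^+ 2.
Proof. by rewrite ip_norm sqr_sqrtr// ip_ge0. Qed.

Lemma ip_cauchy x y : `|ip x y| <= `|x| * `|y|.
Proof.
have [->|y0] := eqVneq y 0.
  by have := ipZr 0 x 0; rewrite scale0r mul0r => ->; rewrite normr0 mulr_ge0.
have ny : 0 < `|y| by rewrite normr_gt0.
rewrite -ler_sqr ?nnegrE ?mulr_ge0// real_normK ?num_real// exprMn -!ip_sqr_norm.
have yy : 0 < ip y y by rewrite ip_sqr_norm exprn_gt0.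
have := ip_ge0 (ip y y *: x - ip x y *: y).
rewrite -scaleNr !(ipDl, ipDr, ipZl, ipZr) (ipC y x) => h.
rewrite -subr_ge0 -(pmulr_rge0 _ yy).
by apply: le_trans h _; rewrite le_eqVlt; apply/orP; left; apply/eqP; ring.
Qed.

(** A named function, so that it can carry a linear structure. *)
Definition ip_with y x : R := ip x y.

Lemma ip_with_linear y : linear (ip_with y : H -> (R : normedModType R)).
Proof. by move=> k x z; rewrite /ip_with ipDl ipZl. Qed.

HB.instance Definition _ y :=
  GRing.isLinear.Build R H (R : normedModType R) _ (ip_with y) (ip_with_linear y).

Lemma ip_with_continuous y : continuous (ip_with y : H -> (R : normedModType R)).
Proof.
apply/(linear_bounded_continuous (ip_with y : {linear H -> (R : normedModType R)})).
apply/linear_boundedP; near=> M => x.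
rewrite /= /ip_with (le_trans (ip_cauchy _ _))// mulrC ler_wpM2r//.
Unshelve. all: by end_near. Qed.

Lemma is_diff_ip_with (F dF : R * R -> H) (z : R * R) y :
  is_diff z F dF -> is_diff z (fun w => ip (F w) y) (fun v => ip (dF v) y).
Proof.
move=> hF.
have hL : is_diff (F z) (ip_with y : H -> (R : normedModType R)) (ip_with y).
  split; first by apply: linear_differentiable; exact: ip_with_continuous.
  by apply: diff_lin; exact: ip_with_continuous.
exact: (is_diff_comp hF hL).
Qed.

Lemma plane_linear (f : {linear (R * R)%type -> H}) v :
  f v = v.1 *: f (1, 0) + v.2 *: f (0, 1).
Proof.
rewrite -!linearZ -linearD; congr (f _); case: v => a b /=.
by apply: injective_projections; rewrite /= /GRing.scale/=; ring.
Qed.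

(** The differential of a component, written in coordinates. *)
Lemma is_diff_ip_plane (F : R * R -> H) (z : R * R) y : differentiable F z ->
  is_diff z (fun w => ip (F w) y)
    (fun v => v.1 * ip ('d F z (1, 0)) y + v.2 * ip ('d F z (0, 1)) y).
Proof.
move=> dF.
apply: (is_diff_eq (is_diff_ip_with y (differentiableP dF))).
by apply/funext => v; rewrite (plane_linear ('d F z)) ipDl !ipZl.
Qed.

Lemma open_unit_disk : open (unit_disk R).
Proof.
rewrite (_ : unit_disk R = (fun z : R * R => z.1 * z.1 + z.2 * z.2) @^-1` [set s | s < 1]); last first.
  apply/funext => z; apply/propext; rewrite /unit_disk /eucl/= -!expr2.
  by rewrite -{1}[1]sqrtr1 ltr_sqrt.
apply: open_comp; last exact: open_lt.
move=> z _.
by apply: cvgD; apply: cvgM; [exact: cvg_fst|exact: cvg_fst|exact: cvg_snd|exact: cvg_snd].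
Qed.

(** Every component of a harmonic map is harmonic, with the components of the
   derivatives of the map as its jet. *)
Lemma harmonic_jet_ip (F : R * R -> H) y : harmonic_on (unit_disk R) F ->
  let F1 := fun w => 'd F w (1, 0) in
  let F2 := fun w => 'd F w (0, 1) in
  harmonic_jet (@unit_disk R) (fun w => ip (F w) y)
    (fun w => ip (F1 w) y) (fun w => ip (F2 w) y)
    (fun w => ip ('d F1 w (1, 0)) y) (fun w => ip ('d F1 w (0, 1)) y)
    (fun w => ip ('d F2 w (1, 0)) y) (fun w => ip ('d F2 w (0, 1)) y).
Proof.
move=> [[dF ddF] lapF] F1 F2.
have cip (G : R * R -> H) (z : R * R) : {for z, continuous G} ->
    {for z, continuous (fun w => ip (G w) y)}.
  by move=> cG; apply: (@continuous_comp _ _ _ G (ip_with y)) => //; exact: ip_with_continuous.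
split.
- by move=> z Dz; apply: is_diff_ip_plane; exact: dF.
- by move=> z Dz; apply: is_diff_ip_plane; exact: (ddF (1, 0)).1.
- by move=> z Dz; apply: is_diff_ip_plane; exact: (ddF (0, 1)).1.
- by move=> z Dz; apply: cip; exact: ((ddF (1, 0)).2 (1, 0)).
- by move=> z Dz; apply: cip; exact: ((ddF (1, 0)).2 (0, 1)).
- by move=> z Dz; apply: cip; exact: ((ddF (0, 1)).2 (1, 0)).
- by move=> z Dz; apply: cip; exact: ((ddF (0, 1)).2 (0, 1)).
- move=> z Dz; rewrite -ipDl.
  (* ['D_v F] agrees with ['d F _ v] on the disk only, hence near [z]. *)
  have DE v : 'D_v ('D_v F) z = 'd (fun w => 'd F w v) z v.
    rewrite -deriveE; last exact: (ddF v).1.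
    apply: near_eq_derive; near=> w; rewrite deriveE//; apply: dF.
    by near: w; exact: (open_nbhs_nbhs (conj open_unit_disk Dz)).
  have := lapF z Dz; rewrite /laplacian !DE => ->.
  by have := ipZl 0 0 y; rewrite scale0r mul0r.
Unshelve. all: by end_near. Qed.

(** * Duality with a test field on the circle *)

(** Lets the radius of the circles tend to one. *)
Lemma le_limit1 (x y m : R) : (forall r, 0 < r < 1 -> x + r * y <= m) -> x + y <= m.
Proof.
move=> h; rewrite leNgt; apply/negP => lt_m.
have d0 : 0 < x + y - m by rewrite subr_gt0.
have half : 0 < (2^-1 : R) < 1 by lra.
have h2 := h _ half.
have [y0|y0] := leP y 0; first by lra.
have xm : x < m by lra.
pose r := 1 - (x + y - m) / (2 * y).
have rE : r * y = y - (x + y - m) / 2 by rewrite /r; field; rewrite gt_eqF.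
have r01 : 0 < r < 1.
  have -> : r = (y - x + m) / (2 * y) by rewrite /r; field; rewrite gt_eqF.
  by rewrite divr_gt0 ?ltr_pdivrMr/=; nra.
by have := h r r01; rewrite rE; lra.
Qed.

(** The squared norm is [rho^2 |n|^2 + C^2 (g1^2 + g2^2)], that is
   [rho^2 (1 - C^2) + C^2 rho^2]. *)
Lemma test_field_norm (n f1 f2 : H) (C rho g1 g2 : R) :
  ip f1 f1 = 1 -> ip f2 f2 = 1 -> ip f1 f2 = 0 -> ip n f1 = 0 -> ip n f2 = 0 ->
  C ^+ 2 = 1 - `|n| ^+ 2 -> g1 ^+ 2 + g2 ^+ 2 = rho ^+ 2 -> 0 <= rho ->
  `|rho *: n + (C * g1) *: f1 + (C * g2) *: f2| = rho.
Proof.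
move=> f11 f22 f12 n1 n2 C2 g_rho rho0.
apply/eqP; rewrite -(@eqrXn2 _ 2)// -ip_sqr_norm; apply/eqP.
rewrite !(ipDl, ipDr, ipZl, ipZr) (ipC f1 n) (ipC f2 n) (ipC f2 f1) f11 f22 f12 n1 n2.
have -> : ip n n = 1 - C ^+ 2 by rewrite C2 ip_sqr_norm; ring.
transitivity (rho ^+ 2 * (1 - C ^+ 2) + C ^+ 2 * (g1 ^+ 2 + g2 ^+ 2)); first by ring.
by rewrite g_rho; ring.
Qed.

(** The orthonormal vectors [f1, f2] diagonalize the differential; along them
   [F (a, b)] has coordinates [C a1], [C a2], and [n] is its normal part, so that
   [C] is the radius of the disk that the plane [n + span(f1, f2)] cuts out of the
   unit ball.  The inequality compares the integrals over circles of [ip F G] and of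
   [rho >= ip F G], where [G = rho n + g1 f1 + g2 f2] is [rho] times the boundary
   values of the conformal parametrization of that disk sending [0] to
   [F (a, b)]. *)
Lemma field_estimate (F : R * R -> H) (a b e1 e2 L l C a1 a2 : R) (f1 f2 n : H) :
  harmonic_on (unit_disk R) F -> (forall z, unit_disk R z -> `|F z| < 1) ->
  a ^+ 2 + b ^+ 2 < 1 -> e1 ^+ 2 + e2 ^+ 2 = 1 ->
  ip f1 f1 = 1 -> ip f2 f2 = 1 -> ip f1 f2 = 0 -> ip n f1 = 0 -> ip n f2 = 0 ->
  F (a, b) = n + (C * a1) *: f1 + (C * a2) *: f2 ->
  C ^+ 2 = 1 - `|n| ^+ 2 -> 0 < C ->
  'd F (a, b) (e1, e2) = L *: f1 -> 'd F (a, b) (- e2, e1) = l *: f2 ->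
  (1 - (a ^+ 2 + b ^+ 2)) * (L * (1 + (a1 ^+ 2 - a2 ^+ 2)) + l * (1 - (a1 ^+ 2 - a2 ^+ 2)))
    <= 2 * C * (1 - (a1 ^+ 2 + a2 ^+ 2)).
Proof.
move=> F_harm F_ball ab e12 f11 f22 f12 n1 n2 Fab C2 C0 dFe dFe'.
set k := 1 - _; set d := a1 ^+ 2 - a2 ^+ 2; set s2 := a1 ^+ 2 + a2 ^+ 2.
(* In the coordinate [zeta = cos t + i sin t] and with [a = a1 + i a2]:
   [rho = |1 + conj a zeta|^2] and
   [g1 + i g2 = C (zeta + 2 a + a^2 conj zeta)]. *)
pose rho t : R := (1 + s2) + (2 * a1 * cos t + 2 * a2 * sin t).
pose g1 t : R := C * (2 * a1) + (C * (1 + d) * cos t + C * (2 * a1 * a2) * sin t).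
pose g2 t : R := C * (2 * a2) + (C * (2 * a1 * a2) * cos t + C * (1 - d) * sin t).
pose mob r t := (mobius1 a b e1 e2 r t, mobius2 a b e1 e2 r t).
have pairing y := harmonic_pairing ab e12 (harmonic_jet_ip y F_harm).
have dirE y : e1 * ip ('d F (a, b) (1, 0)) y + e2 * ip ('d F (a, b) (0, 1)) y = L * ip f1 y.
  by rewrite -[RHS]ipZl -dFe (plane_linear ('d F (a, b)) (e1, e2)) ipDl !ipZl.
have dirE' y : - e2 * ip ('d F (a, b) (1, 0)) y + e1 * ip ('d F (a, b) (0, 1)) y = l * ip f2 y.
  by rewrite -[RHS]ipZl -dFe' (plane_linear ('d F (a, b)) (- e2, e1)) ipDl !ipZl.
have rho_ge0 t : 0 <= rho t.
  have -> : rho t = (1 + (a1 * cos t + a2 * sin t)) ^+ 2 + (a1 * sin t - a2 * cos t) ^+ 2.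
    transitivity (1 + (a1 ^+ 2 + a2 ^+ 2) * (cos t ^+ 2 + sin t ^+ 2) +
      (2 * a1 * cos t + 2 * a2 * sin t)); first by rewrite cos2Dsin2 /rho /s2; ring.
    by ring.
  by rewrite addr_ge0// sqr_ge0.
have gE t : (g1 t / C) ^+ 2 + (g2 t / C) ^+ 2 = rho t ^+ 2.
  have -> : g1 t / C = 2 * a1 + ((1 + d) * cos t + 2 * a1 * a2 * sin t).
    by rewrite /g1; field; rewrite gt_eqF.
  have -> : g2 t / C = 2 * a2 + (2 * a1 * a2 * cos t + (1 - d) * sin t).
    by rewrite /g2; field; rewrite gt_eqF.
  apply/eqP; rewrite -subr_eq0; apply/eqP.
  transitivity ((1 - s2) ^+ 2 * (cos t ^+ 2 + sin t ^+ 2 - 1)); last by rewrite cos2Dsin2; ring.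
  rewrite /rho /d /s2; ring.
have main r : 0 < r < 1 -> (2 * pi) * ((1 + s2) * (1 - C ^+ 2) + 2 * C ^+ 2 * s2) +
    r * (pi * k * C * (L * (1 + d) + l * (1 - d))) <= (2 * pi) * (1 + s2).
  move=> r01.
  have [cn In] := pairing n r (1 + s2) (2 * a1) (2 * a2) r01.
  have [c1 I1] := pairing f1 r (C * (2 * a1)) (C * (1 + d)) (C * (2 * a1 * a2)) r01.
  have [c2 I2] := pairing f2 r (C * (2 * a2)) (C * (2 * a1 * a2)) (C * (1 - d)) r01.
  have ccos : continuous (fun t : R => 2 * a1 * cos t) := continuous_scale (@continuous_cos R).
  have csin : continuous (fun t : R => 2 * a2 * sin t) := continuous_scale (@continuous_sin R).
  have ccst : continuous (fun _ : R => 1 + s2) by move=> t; exact: cvg_cst.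
  have ccs := continuous_add ccos csin.
  have crho : continuous rho := continuous_add ccst ccs.
  have Irho : circle_int rho = 2 * pi * (1 + s2).
    rewrite (circle_intD ccst ccs) (circle_intD ccos csin) circle_int_cst.
    rewrite (circle_intZ _ (@continuous_cos R)) (circle_intZ _ (@continuous_sin R)).
    by rewrite circle_int_cos circle_int_sin; ring.
  (* Pointwise this is Cauchy-Schwarz, as [F] has norm at most one. *)
  have : circle_int (fun t => ip (F (mob r t)) n * rho t +
      (ip (F (mob r t)) f1 * g1 t + ip (F (mob r t)) f2 * g2 t)) <= circle_int rho.
    have c12 := continuous_add c1 c2; have cn12 := continuous_add cn c12.
    apply: (circle_int_le cn12 crho) => t.
    have -> : ip (F (mob r t)) n * rho t + (ip (F (mob r t)) f1 * g1 t + ip (F (mob r t)) f2 * g2 t) =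
      ip (F (mob r t)) (rho t *: n + (C * (g1 t / C)) *: f1 + (C * (g2 t / C)) *: f2).
      by rewrite !ipDr !ipZr; field; rewrite gt_eqF.
    apply: le_trans (ler_norm _) _; apply: le_trans (ip_cauchy _ _) _.
    rewrite test_field_norm// ler_piMl//.
    apply/ltW/F_ball; rewrite /unit_disk/= /eucl/= -sqrtr1 ltr_sqrt//.
    by apply: mobius_disk => //; lra.
  have c12 := continuous_add c1 c2.
  rewrite Irho (circle_intD cn c12) (circle_intD c1 c2) In I1 I2 !dirE !dirE' Fab.
  rewrite !(ipDl, ipZl) (ipC f1 n) (ipC f2 n) (ipC f2 f1) f11 f22 f12 n1 n2.
  have -> : ip n n = 1 - C ^+ 2 by rewrite C2 ip_sqr_norm; ring.
  by congr (_ <= _); rewrite /k /d /s2; ring.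
have h := le_limit1 main.
rewrite -(ler_pM2l (mulr_gt0 (@pi_gt0 R) C0)) -subr_ge0.
by move: h; rewrite -subr_ge0; congr (0 <= _); ring.
Qed.

(** * Singular frames and stretchings *)

(** [(e1, e2)] is the unit vector at half the polar angle of [(X, Y)]: it is
   proportional to [(r + X, Y)] with [r = |(X, Y)|], unless [(X, Y)] lies on the
   closed negative half-axis. *)
Lemma half_angle (X Y : R) : exists e1 e2 : R, [/\ e1 ^+ 2 + e2 ^+ 2 = 1,
  (e1 ^+ 2 - e2 ^+ 2) * Y = 2 * e1 * e2 * X &
  0 <= (e1 ^+ 2 - e2 ^+ 2) * X + 2 * e1 * e2 * Y].
Proof.
pose r := Num.sqrt (X ^+ 2 + Y ^+ 2).
have r0 : 0 <= r by exact: sqrtr_ge0.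
have r2 : r ^+ 2 = X ^+ 2 + Y ^+ 2 by rewrite sqr_sqrtr// addr_ge0// sqr_ge0.
have [rX|rX] := eqVneq (r + X) 0.
  have XE : X = - r by lra.
  have Y0 : Y = 0.
    by apply/eqP; rewrite -sqrf_eq0; apply/eqP; move: r2; rewrite XE sqrrN; lra.
  by exists 0, 1; rewrite Y0 XE; split; [ring|ring|lra].
have m0 : 0 < (r + X) ^+ 2 + Y ^+ 2 by rewrite ltr_pwDl ?sqr_ge0// lt0r sqr_ge0 sqrf_eq0 rX.
have rp : 0 < r.
  rewrite lt0r r0 andbT; apply/eqP => re; move: r2; rewrite re expr0n/= => /esym/eqP.
  rewrite paddr_eq0 ?sqr_ge0// !sqrf_eq0 => /andP[/eqP X0 _].
  by move: rX; rewrite re X0 addr0 eqxx.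
pose m := Num.sqrt ((r + X) ^+ 2 + Y ^+ 2).
have mp : 0 < m by rewrite sqrtr_gt0.
have m2 : m ^+ 2 = 2 * r * (r + X).
  by rewrite sqr_sqrtr ?(ltW m0)//; transitivity (r ^+ 2 + 2 * r * X + (X ^+ 2 + Y ^+ 2));
    [ring|rewrite -r2; ring].
have Y2 : Y ^+ 2 = r ^+ 2 - X ^+ 2 by rewrite r2; ring.
have cosE : ((r + X) / m) ^+ 2 - (Y / m) ^+ 2 = X / r.
  rewrite !expr_div_n -mulrBl m2 Y2; field.
  by rewrite rX gt_eqF.
have sinE : 2 * ((r + X) / m) * (Y / m) = Y / r.
  transitivity (2 * (r + X) * Y / m ^+ 2); first by field; rewrite gt_eqF.
  by rewrite m2; field; rewrite rX gt_eqF.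
exists ((r + X) / m), (Y / m); rewrite cosE sinE; split.
- rewrite !expr_div_n -mulrDl m2 Y2; field.
  by rewrite rX gt_eqF.
- by field; rewrite gt_eqF.
- have -> : X / r * X + Y / r * Y = (X ^+ 2 + Y ^+ 2) / r by field; rewrite gt_eqF.
  by rewrite -r2 divr_ge0// sqr_ge0.
Qed.

(** The singular value decomposition of a linear map on the plane.  For
   [x = A (1, 0)] and [y = A (0, 1)], doubling the angle of [(e1, e2)] turns the
   off-diagonal Gram entry and the difference of the diagonal ones into the two
   expressions of [half_angle] at [X = |x|^2 - |y|^2] and [Y = 2 <x, y>]. *)
Lemma singular_frame (A : {linear (R * R)%type -> H}) : exists e1 e2 : R,
  [/\ e1 ^+ 2 + e2 ^+ 2 = 1, ip (A (e1, e2)) (A (- e2, e1)) = 0 &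
      `|A (- e2, e1)| <= `|A (e1, e2)|].
Proof.
set x := A (1, 0); set y := A (0, 1).
have [e1 [e2 [e12 orth le]]] := half_angle (ip x x - ip y y) (2 * ip x y).
have AE u v : A (u, v) = u *: x + v *: y by exact: plane_linear.
exists e1, e2; split=> //.
- rewrite !AE !(ipDl, ipDr, ipZl, ipZr) (ipC y x).
  apply: (@mulfI _ 2) => //; rewrite mulr0.
  by move/eqP: orth; rewrite -subr_eq0 => /eqP <-; ring.
- rewrite -ler_sqr ?nnegrE// -!ip_sqr_norm !AE !(ipDl, ipDr, ipZl, ipZr) (ipC y x) -subr_ge0.
  by move: le; congr (0 <= _); ring.
Qed.

Lemma frame_decomp (A : {linear (R * R)%type -> H}) (v : R * R) (e1 e2 : R) :
  e1 ^+ 2 + e2 ^+ 2 = 1 ->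
  A v = (v.1 * e1 + v.2 * e2) *: A (e1, e2) + (v.2 * e1 - v.1 * e2) *: A (- e2, e1).
Proof.
move=> e12; rewrite -!linearZ -linearD; congr (A _).
by apply: injective_projections; rewrite /= /GRing.scale/= -[LHS]mulr1 -e12; ring.
Qed.

Lemma norm_linear_le (A : {linear (R * R)%type -> H}) (e1 e2 : R) (v : R * R) :
  e1 ^+ 2 + e2 ^+ 2 = 1 -> ip (A (e1, e2)) (A (- e2, e1)) = 0 ->
  `|A (- e2, e1)| <= `|A (e1, e2)| -> `|A v| <= `|A (e1, e2)| * eucl v.
Proof.
move=> e12 orth le.
rewrite -ler_sqr ?nnegrE ?mulr_ge0 ?sqrtr_ge0// exprMn sqr_sqrtr ?addr_ge0 ?sqr_ge0//.
rewrite -{1}ip_sqr_norm (frame_decomp A v e12) !(ipDl, ipDr, ipZl, ipZr) (ipC (A (- e2, e1))) orth !ip_sqr_norm.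
have le2 : `|A (- e2, e1)| ^+ 2 <= `|A (e1, e2)| ^+ 2 by rewrite ler_sqr ?nnegrE.
set m := `|A (e1, e2)| ^+ 2 in le2 *; set m' := `|A (- e2, e1)| ^+ 2 in le2 *.
have -> : v.1 ^+ 2 + v.2 ^+ 2 = (v.1 * e1 + v.2 * e2) ^+ 2 + (v.2 * e1 - v.1 * e2) ^+ 2.
  by rewrite -[LHS]mulr1 -e12; ring.
set i := v.1 * e1 + _; set j := v.2 * e1 - _.
have h : m' * j ^+ 2 <= m * j ^+ 2 by rewrite ler_wpM2r// sqr_ge0.
by rewrite -subr_ge0; move: h; rewrite -subr_ge0; congr (0 <= _); ring.
Qed.

(** The extremal stretchings bound the singular values; the supremum is taken over
   a bounded set because the larger singular value dominates. *)
Lemma stretching_frame (F : R * R -> H) (z : R * R) (e1 e2 : R) :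
  e1 ^+ 2 + e2 ^+ 2 = 1 -> ip ('d F z (e1, e2)) ('d F z (- e2, e1)) = 0 ->
  `|'d F z (- e2, e1)| <= `|'d F z (e1, e2)| ->
  `|'d F z (e1, e2)| <= max_stretching F z /\ min_stretching F z <= `|'d F z (- e2, e1)|.
Proof.
move=> e12 orth le; split.
- apply: ub_le_sup.
    exists `|'d F z (e1, e2)| => _ [v /= v1 <-].
    by have := norm_linear_le v e12 orth le; rewrite v1 mulr1.
  by exists (e1, e2) => //; rewrite /eucl/= e12 sqrtr1.
- apply: ge_inf; first by exists 0 => _ [v _ <-].
  by exists (- e2, e1) => //; rewrite /eucl/= sqrrN addrC e12 sqrtr1.
Qed.

(** Orthogonal projections are unique: the difference of two candidates lies in
   [L] and is orthogonal to it. *)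
Lemma orth_projE (L : set H) x y : (forall u v, L u -> L v -> L (u - v)) ->
  L y -> (forall w, L w -> ip (x - y) w = 0) -> orth_proj ip L x = y.
Proof.
move=> LB Ly xy; rewrite /orth_proj.
have [] := @getPex _ [set y | L y /\ forall w, L w -> ip (x - y) w = 0] (ex_intro _ y (conj Ly xy)).
set g := get _ => Lg xg; apply/eqP; rewrite -subr_eq0 -normr_eq0 -sqrf_eq0 -ip_sqr_norm.
have Lgy := LB _ _ Lg Ly.
have gyE : g - y = (x - y) - (x - g) by rewrite opprB [RHS]addrC addrA subrK.
by rewrite {1}gyE ipBl xy// xg// subrr.
Qed.

End InnerProduct.

(** * The pointwise Schwarz-Pick estimate *)

Theorem theorem6p8 (R : realType) (H : completeNormedModType R)
    (ip : {dot H for idfun}) (ip_norm : induces_norm ip)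
    (K : R) (K_ge1 : 1 <= K)
    (F : R * R -> H)
    (F_ball : forall z, unit_disk R z -> `|F z| < 1)
    (F_harm : harmonic_on (unit_disk R) F)
    (z0 : R * R) (z0_disk : unit_disk R z0)
    (F_qc : quasiconformal_at K F z0) :
  (forall v : R * R,
     cayley_klein ip (F z0) ('d F z0 v) <= K * poincare z0 v) /\
  (let p := F z0 in
   let Lambda := range ('d F z0) in
   let q := orth_proj ip Lambda p in
   let c := Num.sqrt (1 - `|p| ^+ 2 + `|q| ^+ 2) in
   let s := `|q| / c in
   0 <= s < 1 /\
   forall v : R * R,
     cayley_klein ip p ('d F z0 v) <=
       2 * K / (K + 1 - (K - 1) * s ^+ 2) * poincare z0 v).
Proof.
have [e1 [e2 [e12 orth le_Ae]]] := singular_frame ip_norm ('d F z0).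
have [L_le l_ge] := stretching_frame ip_norm e12 orth le_Ae.
have [l_gt0 _ max_le] := F_qc.
set L := `|'d F z0 (e1, e2)| in le_Ae L_le *.
set l := `|'d F z0 (- e2, e1)| in le_Ae l_ge *.
have l0 : 0 < l by exact: lt_le_trans l_ge.
have L0 : 0 < L by exact: lt_le_trans le_Ae.
have LKl : L <= K * l.
  apply: le_trans L_le (le_trans max_le _).
  by rewrite ler_wpM2l// (le_trans _ K_ge1).
pose f1 := L^-1 *: 'd F z0 (e1, e2); pose f2 := l^-1 *: 'd F z0 (- e2, e1).
have Ae : 'd F z0 (e1, e2) = L *: f1 by rewrite scalerA divff ?gt_eqF// scale1r.
have Ae' : 'd F z0 (- e2, e1) = l *: f2 by rewrite scalerA divff ?gt_eqF// scale1r.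
have f11 : ip f1 f1 = 1.
  by rewrite ipZl ipZr ip_sqr_norm// -/L; field; rewrite gt_eqF.
have f22 : ip f2 f2 = 1.
  by rewrite ipZl ipZr ip_sqr_norm// -/l; field; rewrite gt_eqF.
have f12 : ip f1 f2 = 0 by rewrite ipZl ipZr orth !mulr0.
clearbody f1 f2.
set p := F z0; set Lambda := range ('d F z0).
pose P1 := ip p f1; pose P2 := ip p f2; pose q0 := P1 *: f1 + P2 *: f2.
pose n := p - q0.
have n1 : ip n f1 = 0 by rewrite ipBl ipDl !ipZl f11 (ipC ip f2) f12 /P1; ring.
have n2 : ip n f2 = 0 by rewrite ipBl ipDl !ipZl f22 f12 /P2; ring.
have dE (v : R * R) : 'd F z0 v =
    (L * (v.1 * e1 + v.2 * e2)) *: f1 + (l * (v.2 * e1 - v.1 * e2)) *: f2.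
  by rewrite (frame_decomp ('d F z0) v e12) Ae Ae' !scalerA !(mulrC L) !(mulrC l).
have n_perp v : ip n ('d F z0 v) = 0 by rewrite dE ipDr !ipZr n1 n2; ring.
have qE : orth_proj ip Lambda p = q0.
  apply: (orth_projE ip_norm).
  - by move=> _ _ [u _ <-] [v _ <-]; exists (u - v) => //; rewrite linearB.
  - exists (P1 / L *: (e1, e2) + P2 / l *: (- e2, e1)) => //.
    by rewrite linearD !linearZ/= Ae Ae' !scalerA !divfK ?gt_eqF.
  - by move=> _ [v _ <-]; exact: n_perp.
have q2 : `|q0| ^+ 2 = P1 ^+ 2 + P2 ^+ 2.
  by rewrite -(ip_sqr_norm ip_norm) !(ipDl, ipDr, ipZl, ipZr) f11 f22 (ipC ip f2) f12; ring.
have pE : p = n + q0 by rewrite subrK.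
clearbody n.
have p2 : `|p| ^+ 2 = `|n| ^+ 2 + `|q0| ^+ 2.
  rewrite q2 -!(ip_sqr_norm ip_norm) pE /q0 !(ipDl, ipDr, ipZl, ipZr) (ipC ip f1 n) (ipC ip f2 n) (ipC ip f2 f1).
  by rewrite f11 f22 f12 n1 n2; ring.
have p_lt1 : `|p| ^+ 2 < 1 by rewrite expr_lt1// F_ball.
have z0_lt1 : z0.1 ^+ 2 + z0.2 ^+ 2 < 1.
  by move: z0_disk; rewrite /unit_disk/= /eucl -{1}[1]sqrtr1 ltr_sqrt.
pose C := Num.sqrt (1 - `|p| ^+ 2 + `|q0| ^+ 2).
have C2 : C ^+ 2 = 1 - `|p| ^+ 2 + `|q0| ^+ 2.
  by rewrite sqr_sqrtr// addr_ge0 ?sqr_ge0// subr_ge0 ltW.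
have C0 : 0 < C by rewrite sqrtr_gt0 ltr_pwDl ?sqr_ge0// subr_gt0.
pose s := `|q0| / C.
have s2 : s ^+ 2 = (P1 / C) ^+ 2 + (P2 / C) ^+ 2.
  by rewrite /s !expr_div_n q2; field; rewrite gt_eqF.
have s2C : 1 - `|p| ^+ 2 = C ^+ 2 * (1 - s ^+ 2).
  rewrite /s expr_div_n C2; field; rewrite -C2; first by rewrite sqrf_eq0 gt_eqF.
have s0 : 0 <= s by rewrite divr_ge0// ltW.
have s1 : s < 1.
  rewrite -(@expr_lt1 _ 2)// -subr_gt0 -(pmulr_rgt0 _ (exprn_gt0 2 C0)) -s2C.
  by rewrite subr_gt0.
have s2_lt1 : s ^+ 2 < 1 by rewrite expr_lt1.
have s2_ge0 : 0 <= s ^+ 2 by rewrite sqr_ge0.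
pose kap := 1 - (z0.1 ^+ 2 + z0.2 ^+ 2).
have kap0 : 0 < kap by rewrite subr_gt0.
pose D := K + 1 - (K - 1) * s ^+ 2.
have D2 : 2 <= D by rewrite /D; nra.
have key : L * D * kap <= 2 * K * (C * (1 - s ^+ 2)).
  have z0E : (z0.1, z0.2) = z0 by case: (z0).
  have := @field_estimate R H ip ip_norm F z0.1 z0.2 e1 e2 L l C (P1 / C) (P2 / C) f1 f2 n
    F_harm F_ball z0_lt1 e12 f11 f22 f12 n1 n2.
  rewrite z0E -/p -/kap -s2 => est.
  have pC : p = n + (C * (P1 / C)) *: f1 + (C * (P2 / C)) *: f2.
    by rewrite ![C * _]mulrC !divfK ?gt_eqF// -addrA.
  have nC : C ^+ 2 = 1 - `|n| ^+ 2 by rewrite C2 p2; ring.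
  have {est} := est pC nC C0 Ae Ae'.
  have d_ge : - s ^+ 2 <= (P1 / C) ^+ 2 - (P2 / C) ^+ 2.
    by rewrite s2 -subr_ge0 opprK addrACA addNr addr0 addr_ge0// sqr_ge0.
  move: d_ge; set d := (P1 / C) ^+ 2 - _ => d_ge est.
  (* The difference is [(K l - L) (1 + s^2) + K (d + s^2) (L - l)]. *)
  have LD : L * D <= K * (L * (1 + d) + l * (1 - d)).
    have h1 : 0 <= (K * l - L) * (1 + s ^+ 2) by rewrite mulr_ge0 ?subr_ge0// addr_ge0.
    have h2 : 0 <= K * ((d + s ^+ 2) * (L - l)).
      by rewrite !mulr_ge0 ?subr_ge0//; lra.
    by rewrite -subr_ge0; move: (addr_ge0 h1 h2); congr (0 <= _); rewrite /D; ring.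
  have := ler_wpM2r (ltW kap0) LD; have := ler_wpM2l (le_trans ler01 K_ge1) est.
  by move=> h1 /le_trans; apply; move: h1; congr (_ <= _); ring.
have main v : cayley_klein ip p ('d F z0 v) <= 2 * K / D * poincare z0 v.
  have w_le := norm_linear_le ip_norm v e12 orth le_Ae; rewrite -/L in w_le.
  set w := 'd F z0 v in w_le *; have E0 : 0 <= eucl v by exact: sqrtr_ge0.
  have pw : ip p w = ip q0 w by rewrite pE ipDl n_perp add0r.
  have num_le : Num.sqrt ((1 - `|p| ^+ 2) * `|w| ^+ 2 + ip p w ^+ 2) <= C * (L * eucl v).
    have CL0 : 0 <= C * (L * eucl v) by rewrite !mulr_ge0// ltW.
    rewrite -(ger0_norm CL0) -sqrtr_sqr ler_wsqrtr//.
    have qw : ip p w ^+ 2 <= `|q0| ^+ 2 * `|w| ^+ 2.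
      by rewrite pw -exprMn -real_normK ?num_real// ler_sqr ?nnegrE ?mulr_ge0//; exact: ip_cauchy.
    have w2 : `|w| ^+ 2 <= (L * eucl v) ^+ 2 by rewrite ler_sqr ?nnegrE ?mulr_ge0// ltW.
    rewrite exprMn; apply: le_trans (ler_wpM2l (sqr_ge0 C) w2).
    by rewrite C2 [leRHS]mulrDl lerD2l.
  have den0 : 0 < 1 - `|p| ^+ 2 by rewrite subr_gt0.
  rewrite /cayley_klein ler_pdivrMr//; apply: le_trans num_le _.
  have -> : poincare z0 v = eucl v / kap.
    by rewrite /poincare {2}/eucl sqr_sqrtr// addr_ge0 ?sqr_ge0.
  have D0 : 0 < D by lra.
  (* Both sides are rescaled so that the comparison is exactly [key]. *)
  have -> : C * (L * eucl v) = (L * D * kap) * (C * eucl v / (D * kap)).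
    by field; rewrite !gt_eqF.
  have -> : 2 * K / D * (eucl v / kap) * (1 - `|p| ^+ 2) =
      (2 * K * (C * (1 - s ^+ 2))) * (C * eucl v / (D * kap)).
    by rewrite s2C; field; rewrite !gt_eqF.
  by rewrite ler_wpM2r// divr_ge0 ?mulr_ge0// ltW.
split.
  move=> v; apply: le_trans (main v) _.
  rewrite ler_wpM2r//.
    apply: divr_ge0; first exact: sqrtr_ge0.
    by rewrite /eucl sqr_sqrtr; [exact: ltW kap0|rewrite addr_ge0 ?sqr_ge0].
  rewrite ler_pdivrMr; last by lra.
  by rewrite mulrC ler_wpM2l// (le_trans _ K_ge1).
cbv zeta; rewrite qE -/C -/s; split; first by rewrite s0.
exact: main.
Qed.
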